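(* There exist functions $f$ and $g$ of one variable such that the following holds. Let $\Gamma$ be a tight distance-regular graph with diameter $D\geq 3$, valency $k$, intersection number $b_1$, and eigenvalues $k=\theta_0>\theta_1>\cdots>\theta_D$. Define $b:=b_1/(1+\theta_1)$ and assume $b\geq 2$. Assume also that the eigenvalues $r=-1-\frac{b_1}{1+\theta_D}$ and $s=-1-\frac{b_1}{1+\theta_1}$ of the local graphs of $\Gamma$ are integers. If a local graph of $\Gamma$ (that is, the local graph at some vertex) is neither the block graph of an orthogonal array nor the block graph of a Steiner system, then $k\leq f(b)$ (and hence $D\leq g(b)$).
   Context: Graphs are finite, undirected, connected and simple; $\partial$ is the path-length distance, $\Gamma_i(x)=\{y:\partial(x,y)=i\}$, $\Gamma(x)=\Gamma_1(x)$. A connected graph $\Gamma$ with diameter $D$ is distance-regular if for all $0\le h,i,j\le D$ and all vertices $x,y$ with $\partial(x,y)=h$ the number $p^h_{i,j}=|\Gamma_i(x)\cap\Gamma_j(y)|$ depends only on $h,i,j$; write $c_i=p^i_{1,i-1}$, $a_i=p^i_{1,i}$, $b_i=p^i_{1,i+1}$ and $k=b_0$ (the valency). Such a graph has exactly $D+1$ distinct (adjacency) eigenvalues $k=\theta_0>\theta_1>\cdots>\theta_D$. A distance-regular graph with $D\ge 3$ is tight if it is nonbipartite and $$\left(\theta_1+\frac{k}{a_1+1}\right)\left(\theta_D+\frac{k}{a_1+1}\right)=-\frac{k a_1 b_1}{(a_1+1)^2}.$$ The local graph of $\Gamma$ at a vertex $x$ is the subgraph induced on $\Gamma(x)$. It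 is known that every local graph of a tight distance-regular graph is a connected strongly regular graph with eigenvalues $a_1$, $r=-1-\frac{b_1}{1+\theta_D}$, $s=-1-\frac{b_1}{1+\theta_1}$. An orthogonal array $\operatorname{OA}(p,q)$ is a $p\times q^2$ array with entries in $\{1,\ldots,q\}$ such that the columns of every $2\times q^2$ subarray (formed by two rows) contain each of the $q^2$ ordered pairs exactly once. Its block graph has the columns as vertices, two distinct columns being adjacent if and only if there is a row in which they have the same entry. A Steiner system $S(2,p,q)$ is a $2$-$(q,p,1)$ design: a collection of $p$-subsets (blocks) of a $q$-set (of points) such that every pair of distinct points is contained in exactly one block. Its block graph has the blocks as vertices, two blocks being adjacent if and only if they intersect in exactly one point. *)

(* Defs.v *)
From HB Require Import structures.
From mathcomp Require Import all_boot all_order all_algebra.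
From mathcomp Require Import reals.

Set Implicit Arguments.
Unset Strict Implicit.
Unset Printing Implicit Defensive.

Import Order.TTheory GRing.Theory Num.Theory.

Record sgraph := SGraph {
  vertex :> finType;
  adj : rel vertex;
  adj_sym : symmetric adj;
  adj_irrefl : irreflexive adj
}.

Definition sgraph_iso (G H : sgraph) : Prop :=
  exists f : G -> H, bijective f /\ forall x y : G, adj (f x) (f y) = adj x y.

Definition connected_graph (G : sgraph) : Prop :=
  forall x y : G, connect (@adj G) x y.

Definition bipartite (G : sgraph) : Prop :=
  exists c : G -> bool, forall x y : G, adj x y -> c x != c y.

Definition walk_of_length (G : sgraph) (n : nat) (x y : G) : bool :=
  [exists p : n.-tuple G, path (@adj G) x p && (last x p == y)].

(* A shortest walk has length < #|G|, so this is the least length of a walk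
   from x to y; the value is #|G| when there is no such walk. *)
Definition dist (G : sgraph) (x y : G) : nat :=
  find (fun n => walk_of_length n x y) (iota 0 #|G|).

Definition diameter (G : sgraph) : nat := \max_(x : G) \max_(y : G) dist x y.

Definition sphere (G : sgraph) (i : nat) (x : G) : {set G} :=
  [set y | dist x y == i].

(* p h i j is the intersection number p^h_{i,j}; its values are constrained
   only for indices at most the diameter. *)
Definition distance_regular (G : sgraph) (p : nat -> nat -> nat -> nat) : Prop :=
  connected_graph G /\
  forall h i j : nat,
    h <= diameter G -> i <= diameter G -> j <= diameter G ->
  forall x y : G, dist x y = h -> #|sphere i x :&: sphere j y| = p h i j.

Definition inter_a (p : nat -> nat -> nat -> nat) (i : nat) : nat := p i 1 i.
Definition inter_b (p : nat -> nat -> nat -> nat) (i : nat) : nat := p i 1 i.+1.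
Definition valency (p : nat -> nat -> nat -> nat) : nat := inter_b p 0.

Section Induced.
Variables (G : sgraph) (S : {set G}).

Definition induced_adj : rel {x : G | x \in S} :=
  fun u v => adj (val u) (val v).

Lemma induced_adj_sym : symmetric induced_adj.
Proof. by move=> u v; apply: adj_sym. Qed.

Lemma induced_adj_irrefl : irreflexive induced_adj.
Proof. by move=> u; apply: adj_irrefl. Qed.

Definition induced : sgraph := SGraph induced_adj_sym induced_adj_irrefl.
End Induced.

Definition local_graph (G : sgraph) (x : G) : sgraph := induced (sphere 1 x).

(* The symbols 1, ..., q are encoded as 'I_q. *)
Definition orthogonal_array (p q : nat) (A : 'M['I_q]_(p, q ^ 2)) : Prop :=
  forall i1 i2 : 'I_p, i1 != i2 ->
  forall a b : 'I_q, #|[set j | (A i1 j == a) && (A i2 j == b)]| = 1.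

Section OABlockGraph.
Variables (p q : nat) (A : 'M['I_q]_(p, q ^ 2)).

Definition oa_adj : rel 'I_(q ^ 2) :=
  fun j1 j2 => (j1 != j2) && [exists i, A i j1 == A i j2].

Lemma oa_adj_sym : symmetric oa_adj.
Proof.
move=> j1 j2; rewrite /oa_adj eq_sym; congr (_ && _).
by apply: eq_existsb => i; rewrite eq_sym.
Qed.

Lemma oa_adj_irrefl : irreflexive oa_adj.
Proof. by move=> j; rewrite /oa_adj eqxx. Qed.

Definition oa_block_graph : sgraph := SGraph oa_adj_sym oa_adj_irrefl.
End OABlockGraph.

Definition is_oa_block_graph (G : sgraph) : Prop :=
  exists (p q : nat) (A : 'M['I_q]_(p, q ^ 2)),
    orthogonal_array A /\ sgraph_iso G (oa_block_graph A).

Definition steiner_system (p q : nat) (Bs : {set {set 'I_q}}) : Prop :=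
  (forall B, B \in Bs -> #|B| = p) /\
  (forall x y : 'I_q, x != y ->
     #|[set B in Bs | (x \in B) && (y \in B)]| = 1).

Section SteinerBlockGraph.
Variables (q : nat) (Bs : {set {set 'I_q}}).

Definition steiner_adj : rel {B : {set 'I_q} | B \in Bs} :=
  fun B C => (B != C) && (#|val B :&: val C| == 1).

Lemma steiner_adj_sym : symmetric steiner_adj.
Proof. by move=> B C; rewrite /steiner_adj eq_sym setIC. Qed.

Lemma steiner_adj_irrefl : irreflexive steiner_adj.
Proof. by move=> B; rewrite /steiner_adj eqxx. Qed.

Definition steiner_block_graph : sgraph :=
  SGraph steiner_adj_sym steiner_adj_irrefl.
End SteinerBlockGraph.

Definition is_steiner_block_graph (G : sgraph) : Prop :=
  exists (p q : nat) (Bs : {set {set 'I_q}}),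
    steiner_system p Bs /\ sgraph_iso G (steiner_block_graph Bs).

Local Open Scope ring_scope.

Definition adjmx (R : realType) (G : sgraph) : 'M[R]_#|G| :=
  \matrix_(i, j) (adj (enum_val i) (enum_val j))%:R.

(* theta = [:: theta_0; ...; theta_D] lists the distinct eigenvalues, with
   D the diameter and theta_0 the valency. *)
Definition drg_eigenvalues (R : realType) (G : sgraph)
    (p : nat -> nat -> nat -> nat) (theta : seq R) : Prop :=
  [/\ size theta = (diameter G).+1,
      theta`_0 = (valency p)%:R,
      sorted >%R theta
    & forall t : R, (t \in theta) = eigenvalue (adjmx R G) t].

Definition tight (R : realType) (G : sgraph)
    (p : nat -> nat -> nat -> nat) (theta : seq R) : Prop :=
  let k : R := (valency p)%:R in
  let a1 : R := (inter_a p 1)%:R in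
  let b1 : R := (inter_b p 1)%:R in
  ~ bipartite G /\
  (theta`_1 + k / (a1 + 1)) * (theta`_(diameter G) + k / (a1 + 1))
    = - (k * a1 * b1 / (a1 + 1) ^+ 2).

(* Main.v *)
Require Import Defs.
From HB Require Import structures.
From mathcomp Require Import all_boot all_order all_algebra.
From mathcomp Require Import reals.
From mathcomp Require Import zify ring lra.

Set Implicit Arguments.
Unset Strict Implicit.
Unset Printing Implicit Defensive.

Import Order.TTheory GRing.Theory Num.Theory.

(** Let A be the adjacency matrix of the graph.  For an eigenvalue theta let
    sigma be its cosine sequence: the kernel sigma (dist x y) is, up to a
    positive factor, the orthogonal projection onto the eigenspace, so it is the
    Gram matrix of vectors attached to the vertices ([cosine_sequence]).
    Restricted to the neighbours of a vertex and to vectors of sum zero, this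
    Gram matrix is a multiple of X - eta, where X is the local adjacency matrix
    and eta = -1 - b1 / (1 + theta).  The eigenvalues theta_1 and theta_D thus
    give s <= X <= r off the constant vector, and tightness is the case of
    equality: (X - r) (X - s) has zero diagonal there, hence vanishes
    ([two_eigenvalues]).  So every local graph is strongly regular with
    mu = a1 + r s.  Moreover the Gram matrix of theta_1 kills the local
    eigenvectors for s, that of theta_D those for r, so that for an edge xy the
    vectors of the common neighbours of x and y sum up to a multiple of the sum
    of the vectors of x and y ([dependency]).

    Put s = -m with m = 1 + b.  A local graph is then a strongly regular graph
    with smallest eigenvalue -m, and 2 mu <= a1 because the graph has a geodesic
    of length 3.  Its valency a1 = mu + r m and its order k are bounded once mu
    and r are.  The multiplicity of the eigenvalue r is an integer.  The weak
    absolute bound of [srg_multiplicity] then bounds mu in terms of m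
    ([mu_bound]), and the divisibility of (m - 1) (mu - m^2) (mu - m (m - 1)) by
    r + m bounds r, unless mu = m^2 or mu = m (m - 1) ([r_bound]).

    In these two cases, when r is large, the claw argument of Bose and Laskar
    applies: at each vertex the neighbourhood has cocliques of size m but none of
    size m + 1, so that it is almost a union of m cliques.  The maximal cliques
    of size close to a1 / m are the lines of a partial linear space with m lines
    on each point ([card_lines], [edge_line], [line_unique]).  A point off a line
    is adjacent to at most m of its points.  If mu = m^2, a count forces equality,
    all lines meet, and the dual is a Steiner system
    ([steiner_block_graph_of_lines]).  If mu = m (m - 1), a variance argument
    shows that each line has n = r + m points and that a point off a line is
    adjacent to m - 1 of them; parallelism is an equivalence relation and gives
    an orthogonal array ([oa_block_graph_of_lines]).

    The diameter is at most a1 + 2 ([diameter_le]).  By the dependency above, the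
    number alpha i of common neighbours of x and y at distance i from w, where
    dist x w = i + 1 and dist y w = i, depends on i only.  It is nondecreasing,
    alpha i + alpha j <= a1 if i + j + 1 = D, and it increases strictly as long as
    a1 - alpha i > r, since the neighbours of a vertex that are farther from w
    then induce a connected graph. *)

(** * Path-length distance *)

Section Distance.
Variable G : sgraph.
Implicit Types x y z w : G.

Lemma walk0 x y : walk_of_length 0 x y = (x == y).
Proof.
apply/existsP/eqP => [[p]|->]; first by rewrite tuple0 /= => /eqP.
by exists [tuple]; rewrite /=.
Qed.

Lemma walkS n x y :
  walk_of_length n.+1 x y = [exists z, adj x z && walk_of_length n z y].
Proof.
apply/existsP/existsP => [[p]|[z /andP[xz /existsP[p pP]]]].
  case/tupleP: p => z p /= /andP[/andP[xz pz] l].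
  by exists z; rewrite xz; apply/existsP; exists p; rewrite pz.
by exists [tuple of z :: p]; rewrite /= xz.
Qed.

Lemma dist_le_walk n x y : walk_of_length n x y -> dist x y <= n.
Proof.
move=> wn; rewrite /dist; case: (ltnP n #|G|) => hn; last first.
  by rewrite (leq_trans _ hn) // -[X in _ <= X](size_iota 0) find_size.
rewrite leqNgt; apply/negP => lt.
by have := before_find 0 lt; rewrite nth_iota // add0n wn.
Qed.

Lemma dist_max x y : dist x y <= diameter G.
Proof.
by apply: leq_trans (leq_bigmax (F := fun x => \max_y dist x y) x);
  apply: (leq_bigmax (F := dist x)).
Qed.

Hypothesis conG : connected_graph G.

Lemma walk_dist x y : walk_of_length (dist x y) x y.
Proof.
have /connectP[p xp yl] := conG x y.
have [q [xq uq lq]] : exists q, [/\ path (@adj G) x q, uniq (x :: q) & last x q = y].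
  by case/shortenP: xp yl => q xq uq _ ->; exists q.
have hs : size q < #|G| by have /card_uniqP := uq => /= <-; apply: max_card.
have hh : has (fun n => walk_of_length n x y) (iota 0 #|G|).
  apply/hasP; exists (size q); first by rewrite mem_iota.
  by apply/existsP; exists (in_tuple q); rewrite /= xq lq eqxx.
have := nth_find 0 hh; rewrite has_find size_iota in hh.
by rewrite nth_iota.
Qed.

Lemma dist_refl x : dist x x = 0.
Proof. by apply/eqP; rewrite -leqn0; apply: dist_le_walk; rewrite walk0. Qed.

Lemma dist_eq0 x y : (dist x y == 0) = (x == y).
Proof.
apply/eqP/eqP => [h|->]; last exact: dist_refl.
by have := walk_dist x y; rewrite h walk0 => /eqP.
Qed.

Lemma dist_adj_le x z y : adj x z -> dist x y <= (dist z y).+1.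
Proof.
move=> xz; apply: dist_le_walk; rewrite walkS; apply/existsP; exists z.
by rewrite xz walk_dist.
Qed.

Lemma dist_step i x y : dist x y = i.+1 -> exists2 z, adj x z & dist z y = i.
Proof.
move=> h; have := walk_dist x y; rewrite h walkS => /existsP[z /andP[xz wz]].
exists z => //; apply/eqP; rewrite eqn_leq dist_le_walk //=.
by have := dist_adj_le y xz; rewrite h ltnS.
Qed.

Lemma dist_triangle x z y : dist x y <= dist x z + dist z y.
Proof.
move: {2}(dist x z) (erefl (dist x z)) => n.
elim: n x => [|k IHk] u hu; rewrite hu.
  by move/eqP: hu; rewrite dist_eq0 => /eqP ->.
have [u' uu' hu'] := dist_step hu.
by rewrite (leq_trans (dist_adj_le y uu')) // addSn ltnS -hu' IHk.
Qed.

Lemma dist_split x y n : n <= dist x y ->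
  exists2 z, dist x z = n & dist z y = dist x y - n.
Proof.
elim: n x => [|n IH] x hn; first by exists x; rewrite ?dist_refl ?subn0.
case h : (dist x y) hn => [//|d] hn; have [x' xx' hx'] := dist_step h.
have [|z zn zy] := IH x'; first by rewrite hx'.
exists z; last by rewrite zy hx' subSS.
apply/eqP; rewrite eqn_leq -{1}zn dist_adj_le //=.
rewrite leqNgt; apply/negP => hz.
have := dist_triangle x z y; rewrite h zy hx'; lia.
Qed.

Lemma dist1 x y : (dist x y == 1) = adj x y.
Proof.
apply/eqP/idP => [h|xy].
  by have [z xz /eqP] := dist_step h; rewrite dist_eq0 => /eqP <-.
apply/eqP; rewrite eqn_leq; apply/andP; split.
  by have := dist_adj_le y xy; rewrite dist_refl.
by rewrite lt0n dist_eq0; apply: contraTneq xy => ->; rewrite adj_irrefl.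
Qed.

Lemma dist_sym x y : dist x y = dist y x.
Proof.
suff le (u v : G) : dist u v <= dist v u by apply/eqP; rewrite eqn_leq !le.
move: {2}(dist v u) (erefl (dist v u)) => n.
elim: n v => [|k IHk] v hv; rewrite hv.
  by move/eqP: hv; rewrite dist_eq0 => /eqP ->; rewrite dist_refl.
have [v' vv' hv'] := dist_step hv.
rewrite (leq_trans (dist_triangle u v' v)) // -addn1 leq_add -?hv' ?IHk //.
by move: vv'; rewrite adj_sym -dist1 => /eqP ->.
Qed.

Lemma dist_adj_le_r w x y : adj x y -> dist w x <= (dist w y).+1.
Proof. by rewrite ![dist w _]dist_sym; apply: dist_adj_le. Qed.

Lemma dist_step_r i w x : dist w x = i.+1 -> exists2 y, adj x y & dist w y = i.
Proof.
rewrite dist_sym => /dist_step[y xy h]; exists y => //.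
by rewrite dist_sym.
Qed.

Lemma exists_dist n : n <= diameter G -> 0 < #|G| ->
  exists x y, dist x y = n.
Proof.
move=> hn G0.
have [x xE] := @bigop.eq_bigmax (vertex G) (fun x => \max_y dist x y) G0.
have [y yE] := @bigop.eq_bigmax (vertex G) (dist x) G0.
have dE : dist x y = diameter G by rewrite /diameter xE yE.
have [|z zn _] := @dist_split x y n; first by rewrite dE.
by exists x, z.
Qed.

End Distance.

(** * Cosine sequences *)

(** By the last clause the kernel sigma (dist x y) is a positive multiple of an
    orthogonal projection; its positive semidefiniteness is always used in this
    form. *)
Definition cosine_seq (R : realType) (G : sgraph) (theta : R)
    (sigma : nat -> R) : Prop :=
  [/\ sigma 0 = 1%R,
      forall x y : G,
        (\sum_(z | adj x z) sigma (dist z y) = theta * sigma (dist x y))%R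
    & exists2 c : R, (0 < c)%R & forall x y : G,
        (\sum_z sigma (dist x z) * sigma (dist z y) =
           c * sigma (dist x y))%R].

Section CosineSequence.
Variables (R : realType) (G : sgraph) (p : nat -> nat -> nat -> nat).
Hypothesis drG : distance_regular G p.
Local Notation D := (diameter G).
Local Open Scope ring_scope.

Let conG : connected_graph G := drG.1.

Lemma card_spheres (h i j : nat) (x y : G) : (i <= D)%N -> (j <= D)%N ->
  dist x y = h -> #|sphere i x :&: sphere j y| = p h i j.
Proof. by move=> iD jD hh; apply: drG.2; rewrite // -hh dist_max. Qed.

Lemma sum_by_dist (y : G) (P : pred G) (F : G -> R) :
  \sum_(z | P z) F z = \sum_(j < D.+1) \sum_(z | P z && (dist z y == j)) F z.
Proof.
rewrite (partition_big (fun z => inord (dist z y) : 'I_D.+1) xpredT) //=.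
apply: eq_bigr => j _; apply: eq_bigl => z; congr (_ && _).
by rewrite -val_eqE /= inordK // ltnS dist_max.
Qed.

Lemma sum_dist_dist (F H : nat -> R) (x y : G) :
  \sum_z F (dist x z) * H (dist z y) =
  \sum_(i < D.+1) \sum_(j < D.+1) (p (dist x y) i j)%:R * (F i * H j).
Proof.
rewrite (sum_by_dist x); apply: eq_bigr => i _.
rewrite (sum_by_dist y); apply: eq_bigr => j _.
rewrite -(@card_spheres _ i j x y) ?leq_ord // mulr_natl -sumr_const.
apply: eq_big => z; first by rewrite !inE /= (dist_sym conG z x) (dist_sym conG z y).
by move=> /andP[/eqP zx /eqP zy]; rewrite zy (dist_sym conG x z) zx.
Qed.

Lemma sum_adj_dist (H : nat -> R) (x y : G) : (0 < D)%N ->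
  \sum_(z | adj x z) H (dist z y) =
  \sum_(j < D.+1) (p (dist x y) 1 j)%:R * H j.
Proof.
move=> D0; rewrite (sum_by_dist y); apply: eq_bigr => j _.
rewrite -(@card_spheres _ 1 j x y) ?leq_ord // mulr_natl -sumr_const.
apply: eq_big => z; first by rewrite !inE (dist_sym conG y) dist1.
by move=> /andP[_ /eqP ->].
Qed.

(** A function of the distance that is an eigenvector of the adjacency
    operator is determined by its value at distance 0: in the equation at a
    vertex at distance n, only the value at distance n + 1 is new. *)
Lemma dist_kernel_vanish (K : nat -> R) (theta : R) :
  K 0%N = 0 ->
  (forall x y : G, \sum_(z | adj x z) K (dist z y) = theta * K (dist x y)) ->
  forall x y : G, K (dist x y) = 0.
Proof.
move=> K0 eK x y; move: {2}(dist x y) (leqnn (dist x y)) => n.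
elim: n x y => [|n IH] x y; first by rewrite leqn0 => /eqP ->.
rewrite leq_eqVlt => /orP[/eqP dn|]; last exact: IH.
have [z xz zn] := dist_step conG dn.
have := eK z y; rewrite IH ?zn // mulr0.
have -> : \sum_(z0 | adj z z0) K (dist z0 y) =
    \sum_(z0 | adj z z0 && (dist z0 y == n.+1)) K n.+1.
  rewrite (bigID (fun z0 => dist z0 y == n.+1)) /= [X in _ + X]big1 ?addr0.
    by apply: eq_bigr => z0 /andP[_ /eqP ->].
  move=> z0 /andP[zz0 ne]; apply: IH.
  have := dist_adj_le conG y (x := z0) (z := z).
  by rewrite adj_sym zz0 => /(_ isT); rewrite zn leq_eqVlt (negbTE ne).
rewrite sumr_const -mulr_natr => /eqP; rewrite mulf_eq0 dn.
case/orP=> [/eqP //|]; rewrite pnatr_eq0 => /eqP/card0_eq/(_ x).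
by rewrite unfold_in /= adj_sym xz dn eqxx.
Qed.

(** The cosine sequence is obtained by averaging an eigenvector over the
    spheres around a vertex where it does not vanish.  As a kernel on pairs of
    vertices it is proportional to its square, because the square is again an
    eigenvector that depends on the distance only. *)
Lemma cosine_sequence (theta : R) : (0 < D)%N ->
  eigenvalue (adjmx R G) theta ->
  exists sigma : nat -> R, cosine_seq G theta sigma.
Proof.
move=> D0 /eigenvalueP[v0 ev nz].
pose v (x : G) := v0 0 (enum_rank x).
have vE y : \sum_(z | adj y z) v z = theta * v y.
  have /rowP/(_ (enum_rank y)) := ev; rewrite !mxE => <-.
  rewrite (reindex_onto (@enum_val _ G) enum_rank) => [|i _]; last exact: enum_rankK.
  rewrite [RHS](bigID (fun i => adj y (enum_val i))) /= [X in _ = _ + X]big1.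
    rewrite addr0; apply: eq_big => i.
      by rewrite enum_valK eqxx andbT.
    by move=> /andP[h _]; rewrite mxE /v enum_valK enum_rankK adj_sym h mulr1.
  by move=> i h; rewrite mxE enum_rankK adj_sym (negbTE h) mulr0.
have [x0 vx0] : exists x0, v x0 != 0.
  have /rV0Pn[i hi] := nz; exists (enum_val i); by rewrite /v enum_valK.
pose u i := \sum_(y | dist y x0 == i) v y.
pose k i := #|sphere i x0|.
have k_gt0 i : (i <= D)%N -> (0 < k i)%N.
  move=> iD; have G0 : (0 < #|G|)%N by apply/card_gt0P; exists x0.
  have [x [y xy]] := exists_dist conG iD G0.
  have kE (w : G) : #|sphere i w| = p 0 i i.
    have <- := @card_spheres 0 i i w w iD iD (dist_refl w).
    by rewrite setIid.
  rewrite /k kE -(kE x) card_gt0; apply/set0Pn; exists y; by rewrite inE xy.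
have kp i j : (i <= D)%N -> (j <= D)%N ->
    (k i * p i 1 j = k j * p j 1 i)%N.
  move=> iD jD.
  have E a b : (a <= D)%N -> (b <= D)%N -> (k a * p a 1 b)%N =
      \sum_(y in sphere a x0) \sum_(z in sphere b x0) (adj y z : nat).
    move=> aD bD; rewrite -sum_nat_const; apply: eq_bigr => y.
    rewrite inE (dist_sym conG) => /eqP ya.
    rewrite -(@card_spheres _ 1 b y x0) // -sum1_card.
    rewrite big_mkcond [RHS]big_mkcond; apply: eq_bigr => z _.
    rewrite !inE dist1 //; by case: (adj y z); case: (dist x0 z == b).
  rewrite E // E // exchange_big; apply: eq_bigr => z _; apply: eq_bigr => y _.
  by rewrite adj_sym.
have uE i : (i <= D)%N ->
    theta * u i = \sum_(j < D.+1) (p j 1 i)%:R * u j.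
  move=> iD; rewrite /u big_distrr /=.
  under eq_bigr => y _ do rewrite -vE.
  rewrite (exchange_big_dep xpredT) //= (sum_by_dist x0).
  apply: eq_bigr => j _; rewrite big_distrr /=; apply: eq_bigr => z /eqP zj.
  rewrite sumr_const -[LHS]mulr_natl; congr (_%:R * _).
  rewrite -(@card_spheres _ 1 i z x0) //; apply: eq_card => y.
  by rewrite !inE unfold_in /= dist1 // andbC adj_sym (dist_sym conG y).
pose sg i := u i / ((k i)%:R * v x0).
have ku i : (i <= D)%N -> u i = (k i)%:R * v x0 * sg i.
  move=> iD; rewrite /sg mulrC divfK // mulf_neq0 // pnatr_eq0 -lt0n k_gt0 //.
have s0 : sg 0%N = 1.
  have k0 : k 0%N = 1%N.
    rewrite /k (_ : sphere 0 x0 = [set x0]) ?cards1 //.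
    by apply/setP => y; rewrite !inE dist_eq0 // eq_sym.
  rewrite /sg /u k0 mul1r (big_pred1 x0) ?divff // => y.
  by rewrite dist_eq0.
have sE (x y : G) : \sum_(z | adj x z) sg (dist z y) = theta * sg (dist x y).
  rewrite sum_adj_dist //.
  have iD := dist_max x y; set i := dist x y in iD *.
  have ki0 : (k i)%:R * v x0 != 0 by rewrite mulf_neq0 // pnatr_eq0 -lt0n k_gt0.
  apply: (mulfI ki0); rewrite mulrCA -ku // uE // big_distrr /=.
  apply: eq_bigr => j _; rewrite ku ?leq_ord //.
  have /(congr1 (fun n : nat => n%:R : R)) := @kp i j iD (leq_ord j).
  rewrite !natrM => e.
  transitivity ((k i)%:R * (p i 1 j)%:R * (v x0 * sg j)); first ring.
  rewrite e; ring.
exists sg; split=> //.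
pose T h := \sum_(i < D.+1) \sum_(j < D.+1) (p h i j)%:R * (sg i * sg j).
have TE (x y : G) : \sum_z sg (dist x z) * sg (dist z y) = T (dist x y).
  exact: sum_dist_dist.
exists (T 0%N).
  rewrite -(dist_refl x0) -TE (bigD1 x0) //= dist_refl // s0 mulr1.
  rewrite ltr_pwDl // ?ltr01 // sumr_ge0 // => z _.
  by rewrite [dist z _](dist_sym conG) -expr2 sqr_ge0.
move=> x y; rewrite TE; apply/eqP; rewrite -subr_eq0; apply/eqP.
apply: (@dist_kernel_vanish (fun h => T h - T 0%N * sg h) theta).
  by rewrite s0 mulr1 subrr.
move=> {}x {}y; rewrite sumrB -big_distrr /= sE mulrBr; congr (_ - _); last ring.
under eq_bigr => z _ do rewrite -TE.
rewrite exchange_big /= -TE big_distrr /=; apply: eq_bigr => w _.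
by rewrite -big_distrl /= sE [RHS]mulrA.
Qed.

End CosineSequence.

(** * Symmetric matrices with two eigenvalues off the constant vector *)

Section QuadraticForm.
Variables (R : realFieldType) (n : nat).
Local Open Scope ring_scope.
Implicit Types (Y Z : 'M[R]_n) (f g : 'cV[R]_n).

Definition qform Y f : R := (f^T *m Y *m f) 0 0.

Lemma qformE Y f : qform Y f = \sum_i \sum_j f i 0 * f j 0 * Y i j.
Proof.
rewrite /qform !mxE exchange_big /=; apply: eq_bigr => j _; rewrite !mxE big_distrl /=.
by apply: eq_bigr => i _; rewrite !mxE mulrAC.
Qed.

Lemma qform1E f : qform 1%:M f = \sum_i f i 0 ^+ 2.
Proof.
rewrite /qform mulmx1 !mxE; apply: eq_bigr => i _; by rewrite !mxE expr2.
Qed.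

Lemma qformD Y Z f : qform (Y + Z) f = qform Y f + qform Z f.
Proof. by rewrite /qform mulmxDr mulmxDl mxE. Qed.

Lemma qformN Y f : qform (- Y) f = - qform Y f.
Proof. by rewrite /qform mulmxN mulNmx mxE. Qed.

Lemma qformZ a Y f : qform (a *: Y) f = a * qform Y f.
Proof. by rewrite /qform -scalemxAr -scalemxAl mxE. Qed.

Lemma qform_conj Y Z f : Y^T = Y -> qform (Y *m Z *m Y) f = qform Z (Y *m f).
Proof. by move=> sY; rewrite /qform trmx_mul sY !mulmxA. Qed.

(** A positive semidefinite matrix with zero diagonal vanishes: test it on
    the sums and the differences of two basis vectors. *)
Lemma psd_diag0 Y : Y^T = Y -> (forall f, 0 <= qform Y f) ->
  (forall i, Y i i = 0) -> Y = 0.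
Proof.
move=> sY psd d0; apply/matrixP => i j; rewrite mxE.
have sij : Y j i = Y i j by rewrite -[in LHS]sY mxE.
have E a : qform Y (delta_mx i 0 + a *: delta_mx j 0) = 2 * a * Y i j.
  rewrite /qform (_ : (_ + _)^T = delta_mx 0 i + a *: delta_mx 0 j); last first.
    by apply/matrixP => u v; rewrite !mxE ![_ && (u == _)]andbC.
  rewrite !mulmxDl !mulmxDr.
  rewrite -!scalemxAl -!scalemxAr -?scalemxAl -!rowE -!colE !mxE !d0 sij.
  by rewrite !mulr0 addr0 add0r; ring.
have := psd (delta_mx i 0 + 1 *: delta_mx j 0).
have := psd (delta_mx i 0 + (-1) *: delta_mx j 0).
rewrite !E; lra.
Qed.

Lemma scalar_shift_comm Y (a b : R) :
  (Y - a%:M) *m (Y - b%:M) = (Y - b%:M) *m (Y - a%:M).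
Proof.
rewrite !(mulmxBl, mulmxBr) !(mul_scalar_mx, mul_mx_scalar).
by move: (Y *m Y) => Y2; apply/matrixP => i j; rewrite !mxE; ring.
Qed.

Variables (X : 'M[R]_n) (k r s : R).
Local Notation one := (const_mx 1 : 'cV[R]_n).
Local Notation J := (const_mx 1 : 'M[R]_n).
Hypothesis symX : X^T = X.
Hypothesis regX : X *m one = k *: one.

Lemma one_reg : one^T *m X = k *: one^T.
Proof. by rewrite -{1}symX -trmx_mul regX linearZ. Qed.

Lemma all_onesE : J = one *m one^T.
Proof. by apply/matrixP => i j; rewrite !mxE big_ord1 !mxE mulr1. Qed.

Lemma one_one : one^T *m one = n%:R%:M.
Proof.
apply/matrixP => i j; rewrite !ord1 !mxE eqxx mulr1n.
under eq_bigr => l _ do rewrite !mxE mulr1.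
by rewrite sumr_const card_ord.
Qed.

(** On the orthogonal complement of the constant vector the hypotheses say
    that X - s and r - X are positive semidefinite.  They commute, so their
    product is positive semidefinite there, as the identity
    (r - s) (X - s) (r - X) = (X - s) (r - X) (X - s) + (r - X) (X - s) (r - X)
    shows without diagonalizing.  The numerical relation makes all its diagonal
    entries zero. *)
Lemma two_eigenvalues :
  (0 < n)%N -> s < r ->
  (forall f, one^T *m f = 0 -> s * qform 1%:M f <= qform X f) ->
  (forall f, one^T *m f = 0 -> qform X f <= r * qform 1%:M f) ->
  (forall i, X i i = 0) -> (forall i, (X *m X) i i = k) ->
  n%:R * (k + r * s) = (k - r) * (k - s) ->
  (X - r%:M) *m (X - s%:M) = (k + r * s) *: J.
Proof.
move=> n0 sr lo up X0 XX num.
pose U := X - s%:M; pose V := r%:M - X.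
have sU : U^T = U by rewrite /U linearB /= symX tr_scalar_mx.
have sV : V^T = V by rewrite /V linearB /= symX tr_scalar_mx.
have UVC : U *m V = V *m U.
  by rewrite /V -opprB mulmxN mulNmx scalar_shift_comm.
have UV : U + V = (r - s)%:M.
  by rewrite /U /V addrC addrA subrK raddfB.
have oU : one^T *m U = (k - s) *: one^T.
  by rewrite /U mulmxBr one_reg mul_mx_scalar scalerBl.
have oV : one^T *m V = (r - k) *: one^T.
  by rewrite /V mulmxBr one_reg mul_mx_scalar scalerBl.
have pos f : one^T *m f = 0 -> 0 <= qform (U *m V) f.
  move=> f0.
  have h1 : 0 <= qform (U *m V *m U) f.
    rewrite qform_conj // /V qformD qformN -[r%:M]scalemx1 qformZ subr_ge0.
    apply: up.
    by rewrite mulmxA oU -scalemxAl f0 scaler0.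
  have h2 : 0 <= qform (V *m U *m V) f.
    rewrite qform_conj // /U qformD qformN -[s%:M]scalemx1 qformZ subr_ge0.
    by apply: lo; rewrite mulmxA oV -scalemxAl f0 scaler0.
  have : 0 <= (r - s) * qform (U *m V) f.
    rewrite -qformZ -mul_scalar_mx -UV mulmxDl qformD.
    have -> : U *m (U *m V) = U *m V *m U by rewrite -mulmxA UVC.
    by rewrite mulmxA addr_ge0.
  by rewrite pmulr_rge0 // subr_gt0.
pose P := (k + r * s) *: J + U *m V.
have nR : n%:R != 0 :> R by rewrite pnatr_eq0 -lt0n.
have oneP : one^T *m P = 0.
  have -> : one^T *m P = ((k + r * s) * n%:R + (k - s) * (r - k)) *: one^T.
    rewrite /P mulmxDr mulmxA oU -scalemxAl oV scalerA all_onesE -scalemxAr.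
    by rewrite mulmxA one_one mul_scalar_mx scalerA -scalerDl.
  by rewrite mulrC num (_ : _ + _ = 0) ?scale0r //; ring.
have sP : P^T = P.
  by rewrite /P linearD linearZ /= trmx_const trmx_mul sU sV UVC.
have Pone : P *m one = 0 by rewrite -[P]sP -[one]trmxK -trmx_mul oneP trmx0.
have psdP f : 0 <= qform P f.
  pose a := (one^T *m f) 0 0 / n%:R.
  pose g := f - a *: one.
  have g0 : one^T *m g = 0.
    rewrite /g mulmxBr -scalemxAr one_one; apply/matrixP => i j; rewrite !ord1.
    by rewrite !mxE eqxx mulr1n /a divfK // [X in X - _](_ : _ = (one^T *m f) 0 0) ?subrr // mxE.
  have -> : qform P f = qform P g.
    have {1}-> : f = g + a *: one by rewrite /g subrK.
    have PE : P *m (g + a *: one) = P *m g.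
      by rewrite mulmxDr -scalemxAr Pone scaler0 addr0.
    have gE : (g + a *: one)^T *m P = g^T *m P.
      apply: trmx_inj; rewrite !trmx_mul !trmxK sP; exact: PE.
    by rewrite /qform gE -!mulmxA PE.
  rewrite /P qformD qformZ {1}/qform all_onesE -!mulmxA g0 !mulmx0 mxE mulr0 add0r.
  exact: pos.
have diagP i : P i i = 0.
  rewrite /P /U /V !(mulmxBl, mulmxBr) !(mul_scalar_mx, mul_mx_scalar).
  move: (XX i); move: (X *m X) => XX' XXi.
  by rewrite !mxE XXi !X0 eqxx !mulr1n; ring.
have := psd_diag0 sP psdP diagP; rewrite /P => /eqP; rewrite addr_eq0 => /eqP ->.
by rewrite UVC -mulNmx opprB.
Qed.

End QuadraticForm.

(** * Adjacency matrices and strongly regular graphs *)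

Definition nbr (G : sgraph) (x : G) : {set G} := [set y | adj x y].

Definition regular_graph (G : sgraph) (k : nat) : Prop :=
  forall x : G, #|nbr x| = k.

Definition srg (G : sgraph) (k l mu : nat) : Prop :=
  regular_graph G k /\
  forall x y : G, x != y -> #|nbr x :&: nbr y| = if adj x y then l else mu.

Section AdjacencyMatrix.
Variables (R : realType) (L : sgraph).
Local Open Scope ring_scope.
Local Notation X := (adjmx R L).
Local Notation one := (const_mx 1 : 'cV[R]_#|L|).

Lemma sum_vertices (F : L -> R) : \sum_u F u = \sum_(i < #|L|) F (enum_val i).
Proof. exact: (big_enum_val (A := [pred u : L | true])). Qed.

Lemma adjmx_sym : X^T = X.
Proof. by apply/matrixP => i j; rewrite !mxE adj_sym. Qed.

Lemma adjmx_diag i : X i i = 0.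
Proof. by rewrite mxE adj_irrefl. Qed.

Lemma adjmx_sqr i j :
  (X *m X) i j = #|nbr (enum_val i) :&: nbr (enum_val j)|%:R.
Proof.
rewrite mxE.
transitivity (\sum_(u : L) (adj (enum_val i) u)%:R * (adj u (enum_val j))%:R : R).
  by rewrite sum_vertices; apply: eq_bigr => l _; rewrite !mxE.
rewrite -sum1_card natr_sum [RHS]big_mkcond /=; apply: eq_bigr => u _.
by rewrite !inE (adj_sym u); case: (adj _ u); case: (adj _ u); rewrite /= ?mulr1 ?mul0r ?mulr0.
Qed.

Lemma adjmx_one k : regular_graph L k -> X *m one = k%:R *: one.
Proof.
move=> reg; apply/matrixP => i j; rewrite !mxE mulr1 -(reg (enum_val i)).
rewrite -sum1_card natr_sum [RHS]big_mkcond /= sum_vertices.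
by apply: eq_bigr => l _; rewrite !mxE mulr1 inE; case: (adj _ _).
Qed.

End AdjacencyMatrix.

(** * Local graphs of a distance-regular graph *)

Section LocalGraph.
Variables (R : realType) (G : sgraph).
Hypothesis conG : connected_graph G.
Local Open Scope ring_scope.

Lemma in_sphere1 (x z : G) : (z \in sphere 1 x) = adj x z.
Proof. by rewrite inE dist1. Qed.

Lemma adj_local (x : G) (u : local_graph x) : adj x (val u).
Proof. by rewrite -in_sphere1 (valP u). Qed.

Lemma sum_local (x : G) (P : pred G) (F : G -> R) :
  \sum_(z | adj x z && P z) F z =
  \sum_(u : local_graph x | P (val u)) F (val u).
Proof.
rewrite -(big_sub_cond (mem (sphere 1 x)) P F); apply: eq_bigl => z.
by rewrite -in_sphere1.
Qed.

Lemma card_local (x : G) (P : pred G) :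
  #|[set u : local_graph x | P (val u)]| = #|[set z | adj x z && P z]|.
Proof.
rewrite -!sum1_card; apply/eqP; rewrite -(eqr_nat R) !natr_sum; apply/eqP.
under eq_bigl => u do rewrite inE.
by rewrite -(@sum_local x P (fun=> 1)); apply: eq_bigl => z; rewrite inE.
Qed.

Lemma dist_local (x : G) (u w : local_graph x) : u != w ->
  dist (val u) (val w) = if adj u w then 1%N else 2.
Proof.
move=> uw; have : (dist (val u) (val w) <= 2)%N.
  have d1 (v : local_graph x) : dist x (val v) = 1%N.
    by apply/eqP; rewrite dist1 // adj_local.
  by rewrite (leq_trans (dist_triangle conG _ x _)) // dist_sym // !d1.
have : dist (val u) (val w) != 0%N by rewrite dist_eq0.
rewrite -[adj u w]/(adj (val u) (val w)) -dist1 //.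
by case: (dist _ _) => [|[|[|]]].
Qed.

End LocalGraph.

(** * Intersection numbers in terms of neighbourhoods *)

Section IntersectionNumbers.
Variables (G : sgraph) (p : nat -> nat -> nat -> nat).
Hypothesis drG : distance_regular G p.
Hypothesis D2 : 2 <= diameter G.

Let conG : connected_graph G := drG.1.

Lemma nbrE (x : G) : nbr x = sphere 1 x.
Proof. by apply/setP => y; rewrite !inE dist1. Qed.

Lemma drg_regular : regular_graph G (p 0 1 1).
Proof.
move=> x; rewrite -[nbr x]setIid nbrE; apply: (card_spheres drG).
- exact: leq_trans D2.
- exact: leq_trans D2.
- exact: dist_refl.
Qed.

Lemma drg_common (x y : G) : adj x y -> #|nbr x :&: nbr y| = p 1 1 1.
Proof.
move=> xy; rewrite !nbrE; apply: (card_spheres drG).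
- exact: leq_trans D2.
- exact: leq_trans D2.
- by apply/eqP; rewrite dist1.
Qed.

Lemma drg_valency_split : 0 < #|G| -> p 0 1 1 = 1 + p 1 1 1 + p 1 1 2.
Proof.
move=> G0; have D1 : 1 <= diameter G by exact: leq_trans D2.
have [x [y dxy]] := exists_dist conG D1 G0.
have xy : adj x y by rewrite -dist1 // dxy.
rewrite -(drg_regular x) -(drg_common xy) -(card_spheres drG D1 D2 dxy).
rewrite (cardsD1 y (nbr x)) !inE xy -addnA; congr (1 + _).
rewrite -(cardsID (nbr y) (nbr x :\ y)); congr (_ + _); apply: eq_card => z.
  rewrite !inE andbC [RHS]andbC; case yz: (adj y z) => //=.
  by rewrite andbC; case: eqP yz => [->|]; rewrite ?adj_irrefl ?andbT.
rewrite !inE dist1 // andbCA; case xz : (adj x z) => //=; rewrite ?andbF //.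
rewrite andbC -(dist_eq0 conG) -dist1 // (dist_sym conG z).
have := dist_adj_le conG z (x := y) (z := x); rewrite adj_sym xy => /(_ isT).
move: xz; rewrite -dist1 // => /eqP ->.
by case: (dist y z) => [|[|[|n]]].
Qed.

End IntersectionNumbers.

(** * Local spectrum of a tight distance-regular graph *)

Section LocalSpectrum.
Variables (R : realType) (G : sgraph) (k a1 b1 : nat).
Hypothesis conG : connected_graph G.
Hypothesis regG : regular_graph G k.
Hypothesis commG : forall x y : G, adj x y -> #|nbr x :&: nbr y| = a1.
Hypothesis kE : k = 1 + a1 + b1.
Hypothesis b1_gt0 : 0 < b1.
Hypothesis G_gt0 : 0 < #|G|.
Local Open Scope ring_scope.

Lemma sum_nbr_const (x : G) (c : R) : \sum_(z | adj x z) c = k%:R * c.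
Proof.
rewrite -(regG x) sumr_const mulr_natl; congr (_ *+ _).
by apply: eq_card => z; rewrite inE.
Qed.

Lemma cos1 theta sigma : cosine_seq (R := R) G theta sigma ->
  k%:R * sigma 1%N = theta.
Proof.
move=> [s0 sE _]; have /card_gt0P[x _] := G_gt0.
have := sE x x; rewrite dist_refl s0 mulr1 => <-.
rewrite -(sum_nbr_const x); apply: eq_bigr => z xz; congr sigma.
by apply/eqP; rewrite eq_sym dist_sym // dist1.
Qed.

Lemma exists_edge : exists x y : G, adj x y.
Proof.
have /card_gt0P[x _] := G_gt0; exists x.
have : (0 < #|nbr x|)%N by rewrite regG kE.
by case/card_gt0P => y; rewrite inE; exists y.
Qed.

Lemma cos2 theta sigma : cosine_seq (R := R) G theta sigma ->
  1 + a1%:R * sigma 1%N + b1%:R * sigma 2 = theta * sigma 1%N.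
Proof.
move=> [s0 sE _]; have [x [y xy]] := exists_edge.
have d1 : dist x y = 1%N by apply/eqP; rewrite dist1.
have := sE x y; rewrite d1 => <-.
rewrite (bigD1 y) //= dist_refl s0 -addrA; congr (_ + _).
rewrite (bigID (fun z => adj y z)) /=; congr (_ + _).
  rewrite -(commG xy) mulr_natl -sumr_const; apply: eq_big => z.
    rewrite !inE; case: (adj x z) => //=.
    by case: eqP => // ->; rewrite adj_irrefl.
  by rewrite !inE => /andP[_ yz]; congr sigma; apply/eqP; rewrite eq_sym dist1 // adj_sym.
have -> : b1 = #|[set z | adj x z && (z != y) && ~~ adj y z]|.
  have := regG x; rewrite (cardsD1 y (nbr x)) inE xy kE -addnA => /addnI.
  rewrite -(cardsID (nbr y)) (_ : (nbr x :\ y) :&: nbr y = nbr x :&: nbr y).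
    rewrite commG // => /addnI <-; apply: eq_card => z; rewrite !inE.
    by rewrite andbC [_ && adj x z]andbC.
  apply/setP => z; rewrite !inE; case yz : (adj y z); rewrite ?andbF ?andbT //.
  by case: eqP yz => // ->; rewrite adj_irrefl.
rewrite mulr_natl -sumr_const; apply: eq_big => z; first by rewrite inE.
rewrite inE => /andP[/andP[xz zy] nyz]; congr sigma.
move: zy nyz; rewrite -(dist_eq0 conG) -dist1 // (dist_sym conG y).
have := dist_adj_le conG y (x := z) (z := x); rewrite adj_sym xz => /(_ isT).
by rewrite d1; case: (dist z y) => [|[|[|n]]].
Qed.

Section OneEigenvalue.
Variables (theta : R) (sigma : nat -> R).
Hypothesis cosS : cosine_seq G theta sigma.
Hypothesis theta_m1 : 1 + theta != 0.
Let eta : R := -1 - b1%:R / (1 + theta).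
Let tau : R := sigma 1%N - sigma 2.

Lemma cos_tau : b1%:R * tau = (1 - sigma 1%N) * (1 + theta).
Proof.
have e1 := cos1 cosS; have e2 := cos2 cosS.
have ek : k%:R = 1 + a1%:R + b1%:R :> R by rewrite kE !natrD.
have e1' : (1 + a1%:R + b1%:R) * sigma 1%N = theta by rewrite -ek.
rewrite /tau; lra.
Qed.

Lemma cos_eta : 1 - sigma 2 = - eta * tau.
Proof.
have h : 1 - sigma 1%N = b1%:R / (1 + theta) * tau.
  by rewrite mulrAC cos_tau mulfK.
rewrite (_ : 1 - sigma 2 = 1 - sigma 1%N + tau); last by rewrite /tau; ring.
by rewrite h /eta; ring.
Qed.

(** The Gram matrix of the projections of the neighbours of x onto the
    eigenspace of theta is a combination of the identity, the local adjacency
    matrix X and the all-ones matrix.  Off the constant vector it is therefore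
    a multiple of X - eta, and the sign of the multiple decides on which side
    of eta the local eigenvalues lie. *)
Lemma local_form (x : G) (f : 'cV[R]_#|local_graph x|) :
  (const_mx 1 : 'cV_#|local_graph x|)^T *m f = 0 ->
  exists2 c : R, 0 < c &
    \sum_w (\sum_i f i 0 * sigma (dist (val (enum_val i)) w)) ^+ 2 =
    c * (tau * (qform (adjmx R (local_graph x)) f - eta * qform 1%:M f)).
Proof.
move=> f0; have [s0 _ [c c0 cE]] := cosS; exists c => //.
pose S := (1 - sigma 2) *: 1%:M + tau *: adjmx R (local_graph x)
          + sigma 2 *: (const_mx 1 *m (const_mx 1 : 'cV_#|local_graph x|)^T).
have SE i j : sigma (dist (val (enum_val i : local_graph x))
                          (val (enum_val j : local_graph x))) = S i j.
  rewrite !mxE big_ord1 !mxE !mulr1; have [->|ij] := eqVneq i j.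
    by rewrite dist_refl s0 adj_irrefl mulr0 addr0 mulr1 subrK.
  rewrite dist_local //; last by rewrite (inj_eq enum_val_inj).
  by case: (adj _ _); rewrite /tau ?mulr0 ?mulr1 ?add0r // subrK.
transitivity (c * qform S f).
  rewrite qformE big_distrr /=.
  under eq_bigr => w _ do rewrite expr2 big_distrl /=.
  rewrite exchange_big /=; apply: eq_bigr => i _.
  under eq_bigr => w _ do rewrite big_distrr /=.
  rewrite exchange_big /= big_distrr /=; apply: eq_bigr => j _.
  rewrite -SE mulrCA -cE big_distrr /=; apply: eq_bigr => w _.
  by rewrite (dist_sym conG w) mulrACA.
rewrite /S !qformD !qformZ cos_eta [qform (_ *m _) f]/qform -!mulmxA f0.
by rewrite !mulmx0 mxE mulr0 addr0; ring.
Qed.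

End OneEigenvalue.

Section TwoEigenvalues.
Variables (t1 tD : R) (sigma rho : nat -> R).
Hypothesis cosS : cosine_seq G t1 sigma.
Hypothesis cosR : cosine_seq G tD rho.
Hypothesis t1k : t1 < k%:R.
Hypothesis t1_gt : 0 < 1 + t1.
Hypothesis tD_lt : 1 + tD < 0.
Let s : R := -1 - b1%:R / (1 + t1).
Let r : R := -1 - b1%:R / (1 + tD).
Hypothesis num : k%:R * (a1%:R + r * s) = (a1%:R - r) * (a1%:R - s).

Let b1R : 0 < b1%:R :> R. Proof. by rewrite ltr0n. Qed.
Let k0 : 0 < k%:R :> R. Proof. by rewrite ltr0n kE. Qed.

Lemma local_r_gt : -1 < r.
Proof. by rewrite /r -subr_gt0 opprK addrC addrA subrr add0r -mulrN -invrN divr_gt0 // oppr_gt0. Qed.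

Lemma local_s_lt : s < -1.
Proof. by rewrite /s -subr_gt0 opprB addrC subrK divr_gt0. Qed.

Lemma cos1_lt : sigma 1%N < 1.
Proof.
by rewrite -(ltr_pM2l k0) mulr1 (cos1 cosS).
Qed.

Lemma cos1D_lt : rho 1%N < 1.
Proof.
rewrite -(ltr_pM2l k0) mulr1 (cos1 cosR).
by have := tD_lt; have := k0; lra.
Qed.

Lemma local_regular (x : G) : regular_graph (local_graph x) a1.
Proof.
move=> u; rewrite -(commG (adj_local conG u)).
rewrite (@card_local R G conG x (fun z => adj (val u) z)).
by apply: eq_card => z; rewrite !inE.
Qed.

Lemma card_local_graph (x : G) : #|local_graph x| = k.
Proof.
rewrite -(regG x) card_sig; apply: eq_card => z.
by rewrite !inE dist1.
Qed.

Lemma local_ge_s (x : G) (f : 'cV[R]_#|local_graph x|) :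
  (const_mx 1 : 'cV_#|local_graph x|)^T *m f = 0 ->
  s * qform 1%:M f <= qform (adjmx R (local_graph x)) f.
Proof.
move=> f0; have [c c0 cE] := local_form cosS (lt0r_neq0 t1_gt) f0.
have tau0 : 0 < sigma 1%N - sigma 2.
  rewrite -(pmulr_rgt0 _ b1R) (cos_tau cosS) mulr_gt0 //.
  by rewrite subr_gt0 cos1_lt.
have : 0 <= c * ((sigma 1%N - sigma 2) *
    (qform (adjmx R (local_graph x)) f - s * qform 1%:M f)).
  by rewrite -cE sumr_ge0 // => w _; rewrite sqr_ge0.
by rewrite pmulr_rge0 // pmulr_rge0 // subr_ge0.
Qed.

Lemma local_le_r (x : G) (f : 'cV[R]_#|local_graph x|) :
  (const_mx 1 : 'cV_#|local_graph x|)^T *m f = 0 ->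
  qform (adjmx R (local_graph x)) f <= r * qform 1%:M f.
Proof.
move=> f0; have [c c0 cE] := local_form cosR (ltr0_neq0 tD_lt) f0.
have tau0 : rho 1%N - rho 2 < 0.
  rewrite -(pmulr_rlt0 _ b1R) (cos_tau cosR) pmulr_rlt0 //.
  by rewrite subr_gt0 cos1D_lt.
have : 0 <= c * ((rho 1%N - rho 2) *
    (qform (adjmx R (local_graph x)) f - r * qform 1%:M f)).
  by rewrite -cE sumr_ge0 // => w _; rewrite sqr_ge0.
by rewrite pmulr_rge0 // nmulr_rge0 // subr_le0.
Qed.

Lemma local_le_r_sum (x : G) (f : G -> R) :
  \sum_(z | adj x z) f z = 0 ->
  \sum_(z | adj x z) \sum_(z' | adj x z' && adj z z') f z * f z' <=
  r * \sum_(z | adj x z) f z ^+ 2.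
Proof.
have locT (F : G -> R) : \sum_(z | adj x z) F z =
    \sum_(i < #|local_graph x|) F (val (enum_val i)).
  rewrite -(sum_vertices (fun u : local_graph x => F (val u))).
  by rewrite -(@sum_local R G conG x xpredT); apply: eq_bigl => z; rewrite andbT.
move=> f0; pose F : 'cV[R]_#|local_graph x| := \col_i f (val (enum_val i)).
have F0 : (const_mx 1 : 'cV_#|local_graph x|)^T *m F = 0.
  apply/matrixP => i j; rewrite !mxE -[RHS]f0 locT; apply: eq_bigr => u _.
  by rewrite !mxE mul1r.
have := local_le_r F0; rewrite qform1E qformE !locT.
congr (_ <= r * _); last by apply: eq_bigr => i _; rewrite mxE.
apply: eq_bigr => i _; rewrite (@sum_local R G conG x).
rewrite [RHS]big_mkcond [RHS]sum_vertices; apply: eq_bigr => j _; rewrite !mxE /= /induced_adj.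
by case: (adj _ _); rewrite ?mulr1 ?mulr0.
Qed.

(** Tightness is the case of equality in the bounds s <= X <= r: the local
    graph has no other eigenvalue than r and s off the constant vector. *)
Lemma local_two_eigenvalues (x : G) :
  (adjmx R (local_graph x) - r%:M) *m (adjmx R (local_graph x) - s%:M) =
  (a1%:R + r * s) *: const_mx 1.
Proof.
apply: two_eigenvalues.
- exact: adjmx_sym.
- exact/adjmx_one/local_regular.
- by rewrite card_local_graph kE.
- by have := local_r_gt; have := local_s_lt; lra.
- exact: local_ge_s.
- exact: local_le_r.
- exact: adjmx_diag.
- by move=> i; rewrite adjmx_sqr setIid local_regular.
- by rewrite card_local_graph num.
Qed.

End TwoEigenvalues.
End LocalSpectrum.

Section Dependency.
Variables (R : realType) (G : sgraph) (k a1 b1 : nat).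
Hypothesis conG : connected_graph G.
Hypothesis regG : regular_graph G k.
Hypothesis commG : forall x y : G, adj x y -> #|nbr x :&: nbr y| = a1.
Hypothesis kE : k = 1 + a1 + b1.
Hypothesis G_gt0 : 0 < #|G|.
Local Open Scope ring_scope.
Variables (theta : R) (sigma : nat -> R).
Hypothesis cosS : cosine_seq G theta sigma.
Hypothesis theta_m1 : 1 + theta != 0.
Hypothesis sigma1 : sigma 1%N < 1.
Let eta : R := -1 - b1%:R / (1 + theta).
Variables (eta' c : R).
Hypothesis two_eig : forall x : G,
  (adjmx R (local_graph x) - eta%:M) *m (adjmx R (local_graph x) - eta'%:M) =
  c *: const_mx 1.
Hypothesis num : k%:R * c = (a1%:R - eta) * (a1%:R - eta').

Let k0 : k%:R != 0 :> R. Proof. by rewrite pnatr_eq0 kE. Qed.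

(** The columns of X - eta' off the constant vector are eigenvectors for eta,
    hence killed by the Gram matrix. *)
Lemma dependency_aux (x y w : G) : adj x y ->
  \sum_(z | adj x z && adj y z) sigma (dist z w) =
  eta' * sigma (dist y w) + (a1%:R - eta') * sigma 1%N * sigma (dist x w).
Proof.
move=> xy; pose L := local_graph x; have yL : y \in sphere 1 x by rewrite in_sphere1.
pose u : L := exist _ y yL.
pose X := adjmx R L; pose one : 'cV[R]_#|L| := const_mx 1.
pose e : 'cV[R]_#|L| := delta_mx (enum_rank u) 0.
pose q := (a1%:R - eta') / k%:R.
pose f := (X - eta'%:M) *m e - q *: one.
have regL : X *m one = a1%:R *: one by apply/adjmx_one/local_regular.
have oX : one^T *m X = a1%:R *: one^T.
  by apply: one_reg => //; apply: adjmx_sym.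
have oe : one^T *m e = 1.
  by rewrite /e -colE; apply/matrixP => i j; rewrite !mxE !ord1 eqxx.
have oo : one^T *m one = k%:R%:M.
  by rewrite one_one (card_local_graph conG regG).
have f0 : one^T *m f = 0.
  rewrite /f mulmxBr mulmxA mulmxBr oX mul_mx_scalar -scalerBl -scalemxAl oe.
  rewrite -scalemxAr oo -scalemx1 scalerA divfK //.
  by rewrite (_ : (1 : 'M[R]_1) = 1%:M) ?subrr.
have Uf : (X - eta%:M) *m f = 0.
  rewrite /f mulmxBr mulmxA two_eig -scalemxAl all_onesE -mulmxA oe mulmx1.
  rewrite -scalemxAr mulmxBl regL mul_scalar_mx -scalerBl scalerA.
  by rewrite mulrAC [_ * (_ - eta)]mulrC -num mulrAC mulfV // mul1r subrr.
have form0 : qform X f - eta * qform 1%:M f = 0.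
  rewrite -qformZ scalemx1 -qformN -qformD /qform -mulmxA.
  by rewrite -/X Uf mulmx0 mxE.
have [d d0 dE] := local_form conG regG commG kE G_gt0 cosS theta_m1 f0.
have {}dE : \sum_w0 (\sum_i f i 0 * sigma (dist (val (enum_val i)) w0)) ^+ 2 = 0.
  by rewrite dE form0 !mulr0.
have := psumr_eq0P _ dE => /(_ (fun w0 _ => sqr_ge0 _) w isT) /eqP.
rewrite sqrf_eq0 => /eqP fw0.
have fE i : f i 0 = (adj (enum_val i) u)%:R - eta' * (enum_val i == u)%:R - q.
  rewrite /f /e mulmxBl mul_scalar_mx -colE !mxE enum_rankK mulr1.
  by rewrite andbT -[in LHS](inj_eq enum_val_inj) enum_rankK.
have sumL (F : L -> R) : \sum_(i < #|L|) F (enum_val i) = \sum_v F v.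
  by rewrite sum_vertices.
move: fw0; under eq_bigr => i _ do rewrite fE mulrBl mulrBl.
rewrite !sumrB.
rewrite (sumL (fun v : L => (adj v u)%:R * sigma (dist (val v) w))).
rewrite (sumL (fun v : L => eta' * (v == u)%:R * sigma (dist (val v) w))).
rewrite (sumL (fun v : L => q * sigma (dist (val v) w))).
rewrite -(@sum_local R G conG x xpredT (fun z => q * sigma (dist z w))).
rewrite -big_distrr /=; under [X in _ - _ - _ * X = _]eq_bigl => z do rewrite andbT.
have [_ sE _] := cosS; rewrite sE.
have -> : \sum_(v : L) eta' * (v == u)%:R * sigma (dist (val v) w) =
    eta' * sigma (dist y w).
  rewrite (bigD1 u) //= eqxx mulr1 big1 ?addr0 // => v /negbTE ->.
  by rewrite mulr0 mul0r.
have -> : \sum_(v : L) (adj v u)%:R * sigma (dist (val v) w) =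
    \sum_(z | adj x z && adj y z) sigma (dist z w).
  rewrite (@sum_local R G conG x (fun z => adj y z)) [RHS]big_mkcond /=.
  apply: eq_bigr => v _; rewrite /induced_adj adj_sym.
  by case: (adj y _); rewrite ?mul1r ?mul0r.
have <- := cos1 conG regG G_gt0 cosS.
move/eqP; rewrite subr_eq add0r subr_eq => /eqP ->.
by rewrite /q addrC !mulrA divfK.
Qed.

(** The left side of the previous relation is symmetric in x and y, so that the
    two coefficients on its right side agree. *)
Lemma eta'E : eta' = (a1%:R - eta') * sigma 1%N.
Proof.
have [x [y xy]] := exists_edge regG kE G_gt0; have [s0 _ _] := cosS.
have yx : adj y x by rewrite adj_sym.
have := dependency_aux x xy; rewrite dist_refl s0 (eqP (_ : dist y x == 1%N)) ?dist1 //.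
under eq_bigl => z do rewrite andbC.
rewrite (dependency_aux x yx) dist_refl s0 (eqP (_ : dist y x == 1%N)) ?dist1 //.
move=> /eqP; rewrite -subr_eq0; set t := (_ - _) * _ => h.
have : (eta' - t) * (1 - sigma 1%N) == 0 by rewrite -(eqP h); apply/eqP; ring.
by rewrite mulf_eq0 !subr_eq0 [1 == _]eq_sym (lt_eqF sigma1) orbF => /eqP.
Qed.

Lemma dependency (x y w : G) : adj x y ->
  \sum_(z | adj x z && adj y z) sigma (dist z w) =
  eta' * (sigma (dist x w) + sigma (dist y w)).
Proof.
by move=> xy; rewrite dependency_aux // -eta'E mulrDr addrC.
Qed.

End Dependency.

(** * The diameter of a tight distance-regular graph *)

Section EdgeCounts.
Variables (R : realType) (G : sgraph) (p : nat -> nat -> nat -> nat).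
Hypothesis drG : distance_regular G p.
Local Notation D := (diameter G).
Let conG : connected_graph G := drG.1.
Variable a1 : nat.
Hypothesis commG : forall x y : G, adj x y -> #|nbr x :&: nbr y| = a1.
Hypothesis G_gt0 : 0 < #|G|.
Local Open Scope ring_scope.

(** Geodesics extend, because the number of extensions depends only on the
    distance of the end vertices. *)
Lemma geodesic_extend (i l : nat) (u w : G) : dist u w = i -> (i <= l <= D)%N ->
  exists2 y, dist y w = l & dist u y = (l - i)%N.
Proof.
move=> ui /andP[il lD].
have [x [w0 xw0]] := exists_dist conG lD G_gt0.
have [|z w0z zx] := @dist_split G conG w0 x i; first by rewrite dist_sym // xw0.
have : (0 < #|sphere (l - i) u :&: sphere l w|)%N.
  have d1 : (l - i <= D)%N by rewrite (leq_trans (leq_subr _ _)).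
  rewrite (card_spheres drG d1 lD ui).
  have zw0 : dist z w0 = i by rewrite dist_sym.
  rewrite -(card_spheres drG d1 lD zw0); apply/card_gt0P; exists x.
  by rewrite !inE zx (dist_sym conG w0) xw0 !eqxx.
case/card_gt0P => y; rewrite !inE => /andP[/eqP uy /eqP wy].
by exists y => //; rewrite dist_sym.
Qed.

Lemma exists_dist_edge (i : nat) : (i < D)%N ->
  exists x y w : G, [/\ adj x y, dist x w = i.+1 & dist y w = i].
Proof.
move=> iD; have [x [w xw]] := exists_dist conG iD G_gt0.
by have [y xy yw] := dist_step conG xw; exists x, y, w.
Qed.

Definition common_at (x y w : G) (i : nat) : {set G} :=
  [set z | adj x z && adj y z && (dist z w == i)].

Lemma common_edge_dist (x y w z : G) i : dist x w = i.+1 -> dist y w = i ->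
  adj x z -> adj y z -> (dist z w == i) || (dist z w == i.+1).
Proof.
move=> xw yw xz yz.
have := dist_adj_le conG w xz; rewrite xw ltnS.
have := dist_adj_le conG w (x := z) (z := y); rewrite adj_sym yz yw => /(_ isT).
by case: ltngtP => //=; case: ltngtP => // ? ? ? ?; lia.
Qed.

Section OneDependency.
Variables (theta : R) (sigma : nat -> R) (r : R).
Hypothesis cosS : cosine_seq G theta sigma.
Hypothesis dep : forall x y w : G, adj x y ->
  \sum_(z | adj x z && adj y z) sigma (dist z w) =
  r * (sigma (dist x w) + sigma (dist y w)).
Hypothesis r2 : 2 * r != a1%:R.

(** In the eigenvalue equation at distance i, two zeros at i and i + 1 leave only
    the value at i - 1, so that zeros propagate down to sigma 0 = 1. *)
Lemma cosine_no_two_zeros (i : nat) : (i <= D)%N ->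
  sigma i = 0 -> sigma i.+1 = 0 -> False.
Proof.
have [s0 sE _] := cosS; elim: i => [|i IH] iD si sSi.
  by move/eqP: si; rewrite s0 oner_eq0.
apply: IH => //; first exact: ltnW.
have [x [w xw]] := exists_dist conG iD G_gt0.
have [z0 xz0 zw0] := dist_step conG xw.
have := sE x w; rewrite xw si mulr0 (bigID (fun z => dist z w == i)) /=.
rewrite [X in _ + X]big1 ?addr0; last first.
  move=> z /andP[xz zi].
  have := dist_adj_le conG w xz; have := dist_adj_le conG w (x := z) (z := x).
  rewrite adj_sym xz xw => /(_ isT) le1; rewrite ltnS leq_eqVlt eq_sym (negbTE zi) /=.
  rewrite leq_eqVlt => /orP[/eqP <- //|ge]; suff -> : dist z w = i.+2 by [].
  by apply/eqP; rewrite eqn_leq le1.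
under eq_bigr => z /andP[_ /eqP ->] do [].
rewrite sumr_const => /eqP; rewrite mulrn_eq0 => /orP[/eqP/card0_eq/(_ z0)|/eqP //].
by rewrite unfold_in /= xz0 zw0 eqxx.
Qed.

Lemma sum_two_dist (i j : nat) (x y w : G) : adj x y -> i != j ->
  (forall z, adj x z -> adj y z -> (dist z w == i) || (dist z w == j)) ->
  #|common_at x y w i|%:R * sigma i + (a1%:R - #|common_at x y w i|%:R) * sigma j
  = r * (sigma (dist x w) + sigma (dist y w)).
Proof.
move=> xy ij two; rewrite -dep // (bigID (fun z => dist z w == i)) /=.
congr (_ + _).
  rewrite mulr_natl -sumr_const; apply: eq_big => z; first by rewrite inE.
  by rewrite inE => /andP[_ /eqP ->].
rewrite -(commG xy) -(cardsID [set z | dist z w == i]) natrD.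
have -> : nbr x :&: nbr y :&: [set z | dist z w == i] = common_at x y w i.
  by apply/setP => z; rewrite !inE.
rewrite addrC addKr mulr_natl -sumr_const; apply: eq_big => z.
  by rewrite !inE andbC.
rewrite !inE => /andP[zi /andP[xz yz]].
by have := two z xz yz; rewrite (negbTE zi) => /eqP ->.
Qed.

Lemma cosine_step_neq i : (i < D)%N -> sigma i - sigma i.+1 != 0.
Proof.
move=> iD; apply/negP; rewrite subr_eq0 => /eqP e.
have [x [y [w [xy xw yw]]]] := exists_dist_edge iD.
have ne : i != i.+1 by rewrite neq_ltn ltnSn.
have := sum_two_dist xy ne (fun z => common_edge_dist xw yw).
rewrite xw yw e => h.
have : (2 * r - a1%:R) * sigma i.+1 = 0 by move: h; lra.
move/eqP; rewrite mulf_eq0 subr_eq0 (negbTE r2) /= => /eqP s0.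
by apply: (@cosine_no_two_zeros i (ltnW iD)); rewrite ?e.
Qed.

(** The value that the dependency forces on #|common_at x y w i|, for an edge xy
    with x one step farther from w than y: see [card_common_at]. *)
Definition alpha (i : nat) : R :=
  (r * (sigma i + sigma i.+1) - a1%:R * sigma i.+1) / (sigma i - sigma i.+1).

Lemma card_common_at i (x y w : G) : (i < D)%N -> adj x y ->
  dist x w = i.+1 -> dist y w = i -> #|common_at x y w i|%:R = alpha i.
Proof.
move=> iD xy xw yw; have ne : i != i.+1 by rewrite neq_ltn ltnSn.
have := sum_two_dist xy ne (fun z => common_edge_dist xw yw).
rewrite xw yw => h; rewrite /alpha; apply: (canRL (mulfK (cosine_step_neq iD))).
rewrite mulrBr; move: h; lra.
Qed.

Lemma card_common_level i (y z w : G) : (i < D)%N -> adj y z ->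
  dist y w = i.+1 -> dist z w = i.+1 ->
  (forall u, adj y u -> adj z u -> dist u w != i.+2) ->
  #|common_at y z w i|%:R = alpha i - r.
Proof.
move=> iD yz yw zw none; have ne : i != i.+1 by rewrite neq_ltn ltnSn.
have two u : adj y u -> adj z u -> (dist u w == i) || (dist u w == i.+1).
  move=> yu zu; have := none u yu zu; have := dist_adj_le conG w yu.
  have := dist_adj_le conG w (x := u) (z := y); rewrite adj_sym yu yw => /(_ isT).
  lia.
have := sum_two_dist yz ne two; rewrite yw zw => h.
rewrite /alpha; apply/eqP; rewrite eq_sym subr_eq; apply/eqP.
apply: (canLR (mulfK (cosine_step_neq iD))); move: h; lra.
Qed.

End OneDependency.

Section TwoDependencies.
Variables (theta thetaD : R) (sigma rho : nat -> R) (r s : R).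
Hypothesis cosS : cosine_seq G theta sigma.
Hypothesis cosR : cosine_seq G thetaD rho.
Hypothesis depS : forall x y w : G, adj x y ->
  \sum_(z | adj x z && adj y z) sigma (dist z w) =
  r * (sigma (dist x w) + sigma (dist y w)).
Hypothesis depR : forall x y w : G, adj x y ->
  \sum_(z | adj x z && adj y z) rho (dist z w) =
  s * (rho (dist x w) + rho (dist y w)).
Hypothesis r2 : 2 * r < a1%:R.
Hypothesis s2 : 2 * s < a1%:R.
Hypothesis sr : s < r.
Hypothesis local_le : forall (x : G) (f : G -> R),
  \sum_(z | adj x z) f z = 0 ->
  \sum_(z | adj x z) \sum_(z' | adj x z' && adj z z') f z * f z' <=
  r * \sum_(z | adj x z) f z ^+ 2.

Let r2' : 2 * r != a1%:R. Proof. by rewrite lt_eqF. Qed.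
Let s2' : 2 * s != a1%:R. Proof. by rewrite lt_eqF. Qed.
Local Notation al := (alpha sigma r).

Lemma alphaE i (x y w : G) : (i < D)%N -> adj x y ->
  dist x w = i.+1 -> dist y w = i -> #|common_at x y w i|%:R = al i.
Proof. exact: card_common_at cosS depS r2' _ _ _ _. Qed.

Lemma alpha_nat i : (i < D)%N -> exists n : nat, al i = n%:R.
Proof.
move=> iD; have [x [y [w [xy xw yw]]]] := exists_dist_edge iD.
by exists #|common_at x y w i|; rewrite alphaE.
Qed.

(** Two adjacent vertices at the same distance from w have a common neighbour
    one step farther: without it, one and the same number of common neighbours
    one step nearer would be alpha - r by the first relation and alpha - s by
    the second. *)
Lemma common_nbr_farther i (y z w : G) : (i < D)%N -> adj y z ->
  dist y w = i.+1 -> dist z w = i.+1 ->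
  exists u, [/\ adj y u, adj z u & dist u w = i.+2].
Proof.
move=> iD yz yw zw.
have [/existsP[u /and3P[yu zu /eqP uw]]|] :=
  boolP [exists u, [&& adj y u, adj z u & dist u w == i.+2]]; first by exists u.
rewrite negb_exists => /forallP none.
have none' u : adj y u -> adj z u -> dist u w != i.+2.
  by move=> yu zu; have := none u; rewrite yu zu.
have [x0 [y0 [w0 [xy0 xw0 yw0]]]] := exists_dist_edge iD.
have e1 := card_common_level cosS depS r2' iD yz yw zw none'.
have e2 := card_common_level cosR depR s2' iD yz yw zw none'.
have e3 := card_common_at cosS depS r2' iD xy0 xw0 yw0.
have e4 := card_common_at cosR depR s2' iD xy0 xw0 yw0.
by exfalso; move: sr e1 e2; rewrite -e3 -e4; lra.
Qed.

(** The common neighbours counted from a neighbour of w that is nearer to y are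
    also counted from w. *)
Lemma alpha_mono i : (i.+1 < D)%N -> al i <= al i.+1.
Proof.
move=> iD; have [x [y [w [xy xw yw]]]] := exists_dist_edge iD.
have [w' ww' yw'] := dist_step_r conG yw.
have xw' : dist x w' = i.+1.
  apply/eqP; rewrite eqn_leq; apply/andP; split.
    by rewrite -yw' dist_adj_le.
  by rewrite -ltnS -xw dist_adj_le_r.
rewrite -(alphaE iD xy xw yw) -(alphaE (ltnW iD) xy xw' yw') ler_nat.
apply/subset_leq_card/subsetP => z; rewrite !inE => /andP[/andP[xz yz] /eqP zw'].
rewrite xz yz eqn_leq -{1}zw' dist_adj_le_r //=.
by have := dist_adj_le conG w xz; rewrite xw ltnS.
Qed.

Lemma alpha_mono_le i j : (i <= j)%N -> (j < D)%N -> al i <= al j.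
Proof.
move=> ij; rewrite -(subnKC ij); elim: (j - i)%N => [|n IH]; first by rewrite addn0.
rewrite addnS => h; apply: le_trans (alpha_mono h); apply: IH.
exact: ltnW.
Qed.

(** For an edge on a geodesic of length D, the common neighbours counted from one
    end are not counted from the other. *)
Lemma alpha_antipodal i j : (i + j).+1 = D -> al i + al j <= a1%:R.
Proof.
move=> ij; have [v [w vw]] := exists_dist conG (leqnn D) G_gt0.
have [|x wx xv] := @dist_split G conG w v i.+1.
  by rewrite dist_sym // vw -ij ltnS leq_addr.
have xw : dist x w = i.+1 by rewrite dist_sym.
have [y xy yw] := dist_step conG xw.
have xv' : dist x v = j by rewrite xv (dist_sym conG) vw -ij subSS addKn.
have yv : dist y v = j.+1.
  apply/eqP; rewrite eqn_leq -{1}xv' dist_adj_le //; last by rewrite adj_sym.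
  have := dist_triangle conG v y w; rewrite vw yw -ij (dist_sym conG v); lia.
have yx : adj y x by rewrite adj_sym.
have iD : (i < D)%N by rewrite -ij ltnS leq_addr.
have jD : (j < D)%N by rewrite -ij ltnS leq_addl.
rewrite -(alphaE iD xy xw yw) -(alphaE jD yx yv xv') -natrD ler_nat.
rewrite -(commG xy) -cardsUI (_ : _ :&: common_at _ _ _ _ = set0) ?cards0 ?addn0.
  apply/subset_leq_card/subsetP => z; rewrite !inE.
  by case/orP => /andP[/andP[-> ->] _].
apply/setP => z; rewrite !inE; apply/negP.
move=> /andP[/andP[_ /eqP zw] /andP[_ /eqP zv]].
have := dist_triangle conG v z w; rewrite vw (dist_sym conG v) zw zv -ij; lia.
Qed.

(** The neighbours of q one step farther from w induce a regular graph whose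
    valency a1 - alpha exceeds the second local eigenvalue r.  Hence it is
    connected: a nontrivial union of components would give a vector orthogonal
    to the constants with eigenvalue a1 - alpha. *)
Lemma farther_nbrs_connected i (q w : G) (phi : G -> bool) :
  (i < D)%N -> dist q w = i -> r < a1%:R - al i ->
  (forall y z, adj q y -> adj q z -> dist y w = i.+1 -> dist z w = i.+1 ->
     adj y z -> phi y = phi z) ->
  forall y z, adj q y -> adj q z -> dist y w = i.+1 -> dist z w = i.+1 ->
     phi y = phi z.
Proof.
move=> iD qw ral inv.
pose B := [set y | adj q y && (dist y w == i.+1)].
pose B1 := [set y in B | phi y]; pose B2 := [set y in B | ~~ phi y].
suff B12 : (#|B1| == 0)%N || (#|B2| == 0)%N.
  move=> y z qy qz yw zw; move: B12; rewrite !cards_eq0 => /orP[]/eqP/setP E.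
    have := E y; have := E z; rewrite !inE qy qz yw zw eqxx /=.
    by move=> -> ->.
  have := E y; have := E z; rewrite !inE qy qz yw zw eqxx /=.
  by move=> /negbFE -> /negbFE ->.
pose f y : R := if y \in B1 then #|B2|%:R else if y \in B2 then - #|B1|%:R else 0.
have fB y : y \notin B -> f y = 0.
  by rewrite /f /B1 /B2 !inE => /negbTE ->.
have sumf (F : G -> R) : (forall y, y \notin B -> F y = 0) ->
    \sum_(z | adj q z) F z = \sum_(y in B1) F y + \sum_(y in B2) F y.
  move=> F0; rewrite (bigID (mem B)) /= [X in _ + X]big1 ?addr0; last first.
    by move=> y /andP[_ /F0].
  rewrite (bigID phi) /=; congr (_ + _); apply: eq_bigl => y.
    by rewrite !inE; case: (adj q y).
  by rewrite !inE; case: (adj q y).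
have f1 (y : G) : y \in B1 -> f y = #|B2|%:R by rewrite /f => ->.
have f2 (y : G) : y \in B2 -> f y = - #|B1|%:R.
  rewrite /f => h; rewrite h ifF //; move: h; rewrite !inE.
  by case/andP => -> /negbTE ->.
have f0 : \sum_(z | adj q z) f z = 0.
  rewrite sumf // (eq_bigr _ f1) (eq_bigr _ f2) !sumr_const -mulr_natl -[X in _ + X]mulr_natl.
  by ring.
have fsq : \sum_(z | adj q z) f z ^+ 2 =
    #|B1|%:R * #|B2|%:R * (#|B1|%:R + #|B2|%:R).
  rewrite sumf; last by move=> y /fB ->; rewrite expr0n.
  under eq_bigr => y /f1 -> do [].
  under [X in _ + X]eq_bigr => y /f2 -> do [].
  by rewrite !sumr_const -mulr_natl -[X in _ + X]mulr_natl; ring.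
have := local_le f0.
have -> : \sum_(z | adj q z) \sum_(z' | adj q z' && adj z z') f z * f z' =
    (a1%:R - al i) * \sum_(z | adj q z) f z ^+ 2.
  rewrite big_distrr /=; apply: eq_bigr => y qy.
  have [yB|/fB ->] := boolP (y \in B); last first.
    by rewrite big1 ?expr0n ?mulr0 // => z _; rewrite mul0r.
  have yw : dist y w = i.+1 by move: yB; rewrite inE => /andP[_ /eqP].
  rewrite (bigID (fun z => dist z w == i)) /= big1 ?add0r; last first.
    move=> z /andP[_ /eqP zw]; rewrite (fB z) ?mulr0 //.
    by rewrite inE zw eqn_leq ltnn andbF andbF.
  transitivity (\sum_(z in nbr y :&: nbr q :\: common_at y q w i) f y ^+ 2).
    apply: eq_big => z.
      rewrite !inE; case: (adj q z); case: (adj y z); case: (_ == _) => //.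
    move=> /andP[/andP[qz yz] zi]; rewrite expr2; congr (_ * _).
    have yq : adj y q by rewrite adj_sym.
    have := common_edge_dist yw qw yz qz; rewrite (negbTE zi) /= => /eqP zw.
    have zB : z \in B by rewrite inE qz zw eqxx.
    have phiE := inv y z qy qz yw zw yz.
    by move: yB zB; rewrite /f /B1 /B2 ![_ \in [set _ in B | _]]inE => -> ->; rewrite phiE.
  rewrite sumr_const -[LHS]mulr_natl; congr (_ * _).
  have yq : adj y q by rewrite adj_sym.
  rewrite -(alphaE iD yq yw qw) -(commG yq) cardsDS ?natrB //.
    by apply/subset_leq_card/subsetP => z; rewrite !inE => /andP[].
  by apply/subsetP => z; rewrite !inE => /andP[].
rewrite -subr_le0 -mulrBl pmulr_rle0; last by rewrite subr_gt0.
rewrite fsq => h; apply/negPn/negP; rewrite negb_or -!lt0n => /andP[h1 h2].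
have : 0 < #|B1|%:R * #|B2|%:R * (#|B1|%:R + #|B2|%:R) :> R.
  by rewrite -natrD -!natrM ltr0n !muln_gt0 h1 h2 addn_gt0 h1.
by rewrite ltNge h.
Qed.

(** If alpha does not increase from i to i + 1, the set of neighbours of w that
    are nearer to y is the same for adjacent y at distance i + 1 from w: for a
    common neighbour one step farther, two sets of equal size are nested. *)
Lemma alpha_eq_nearer i (y z w w' : G) : (i.+1 < D)%N -> al i = al i.+1 ->
  adj y z -> dist y w = i.+1 -> dist z w = i.+1 ->
  adj w w' -> dist y w' = i -> dist z w' = i.
Proof.
move=> iD ale yz yw zw ww' yw'.
have [u [yu zu uw]] := common_nbr_farther (ltnW iD) yz yw zw.
have uy : adj u y by rewrite adj_sym.
have uw' : dist u w' = i.+1.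
  apply/eqP; rewrite eqn_leq; apply/andP; split.
    by rewrite -yw' dist_adj_le.
  by rewrite -ltnS -uw dist_adj_le_r.
have sub : common_at u y w' i \subset common_at u y w i.+1.
  apply/subsetP => v; rewrite !inE => /andP[/andP[uv yv] /eqP vw'].
  rewrite uv yv eqn_leq -{1}vw' dist_adj_le_r //=.
  by have := dist_adj_le conG w uv; rewrite uw ltnS.
have /eqP cE : #|common_at u y w' i| == #|common_at u y w i.+1|.
  by rewrite -(eqr_nat R) (alphaE (ltnW iD)) // (alphaE iD) // ale.
have /eqP/setP/(_ z) : common_at u y w' i == common_at u y w i.+1.
  by rewrite eqEcard sub cE leqnn.
by rewrite !inE yz zw eqxx adj_sym zu /= => /eqP.
Qed.

(** Suppose alpha does not increase from i to i + 1.  Whether a neighbour w1 of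
    w is nearer to y then does not depend on the vertex y at distance i + 1 from
    w: the common value is propagated down to w along the connected sets of
    farther neighbours.  But both cases occur for a suitable y. *)
Lemma alpha_strict i : (i.+1 < D)%N -> r < a1%:R - al i -> al i < al i.+1.
Proof.
move=> iD ral; rewrite lt_neqAle alpha_mono // andbT; apply/negP => /eqP ale.
have [w [w1 [_ [ww1 _ _]]]] := exists_dist_edge (leq_ltn_trans (leq0n i) (ltnW iD)).
pose phi (y : G) := dist y w1 == i.
have step1 y z : adj y z -> dist y w = i.+1 -> dist z w = i.+1 -> phi y = phi z.
  have imp y' z' : adj y' z' -> dist y' w = i.+1 -> dist z' w = i.+1 ->
      phi y' -> phi z'.
    move=> yz yw zw /eqP yw1; apply/eqP.
    exact: (alpha_eq_nearer iD ale yz yw zw ww1 yw1).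
  move=> yz yw zw; apply/idP/idP; first exact: imp.
  by apply: imp => //; rewrite adj_sym.
have main n : forall j q, (n + j)%N = i.+1 -> dist q w = j ->
    forall y y', dist y w = i.+1 -> dist y' w = i.+1 ->
    dist q y = n -> dist q y' = n -> phi y = phi y'.
  elim: n => [|n IH] j q nj qw y y' yw yw' qy qy'.
    move/eqP: qy; move/eqP: qy'; rewrite !dist_eq0 //.
    by move=> /eqP <- /eqP <-.
  pose psi (q1 : G) := [exists y, [&& dist y w == i.+1, dist q1 y == n & phi y]].
  have njE : (n + j.+1)%N = i.+1 by rewrite addnS -addSn.
  have psiE q1 y1 : dist q1 w = j.+1 -> dist y1 w = i.+1 -> dist q1 y1 = n ->
      psi q1 = phi y1.
    move=> q1w y1w q1y1; apply/existsP/idP.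
      move=> [y2 /and3P[/eqP y2w /eqP q1y2]].
      by rewrite (IH j.+1 q1 njE q1w y2 y1).
    by move=> ph; exists y1; rewrite y1w q1y1 !eqxx.
  have below y1 : dist y1 w = i.+1 -> dist q y1 = n.+1 ->
      exists q1, [/\ adj q q1, dist q1 w = j.+1 & dist q1 y1 = n].
    move=> y1w qy1; have [q1 qq1 q1y1] := dist_step conG qy1; exists q1; split=> //.
    apply/eqP; rewrite eqn_leq -{1}qw dist_adj_le //=; last by rewrite adj_sym.
    have := dist_triangle conG y1 q1 w; rewrite y1w (dist_sym conG y1) q1y1.
    by move: njE; clear; lia.
  have [q1 [qq1 q1w q1y]] := below y yw qy.
  have [q2 [qq2 q2w q2y]] := below y' yw' qy'.
  rewrite -(psiE q1 y) // -(psiE q2 y') //.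
  have jD : (j < D)%N by move: njE iD; clear; lia.
  apply: (@farther_nbrs_connected j q w psi) => //.
    apply: lt_le_trans ral _; rewrite lerD2l lerN2 alpha_mono_le ?(ltnW iD) //.
    by move: njE; clear; lia.
  move=> z z' qz qz' zw z'w zz'.
  have [n0|n0] := posnP n.
    have ji : j = i by move: njE; rewrite n0 add0n => -[].
    rewrite (psiE z z) ?(psiE z' z') ?n0 ?dist_refl ?zw ?z'w ?ji //.
    by apply: step1; rewrite ?zw ?z'w ?ji.
  have [u [zu z'u uw]] := common_nbr_farther jD zz' zw z'w.
  have [|y2 y2w uy2] := @geodesic_extend j.+2 i.+1 u w uw.
    by move: njE n0 iD; clear; lia.
  have far z1 : adj z1 u -> dist z1 w = j.+1 -> dist z1 y2 = n.
    move=> z1u z1w; have := dist_adj_le conG y2 z1u; rewrite uy2.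
    have := dist_triangle conG y2 z1 w; rewrite y2w z1w (dist_sym conG y2).
    by move: njE n0; clear; lia.
  by rewrite (psiE z y2) ?(psiE z' y2) // far.
have ww1d : dist w1 w = 1%N by apply/eqP; rewrite dist1 // adj_sym.
have [|y1 y1w w1y1] := @geodesic_extend 1 i.+1 w1 w ww1d; first exact: ltnW.
have ww1d' : dist w w1 = 1%N by apply/eqP; rewrite dist1.
have [|y2 y2w1 wy2] := @geodesic_extend 1 i.+2 w w1 ww1d'; first exact: iD.
have wy2' : dist w y2 = i.+1 by rewrite wy2 subn1.
have y2w : dist y2 w = i.+1 by rewrite dist_sym.
have wy1 : dist w y1 = i.+1 by rewrite dist_sym.
have := main i.+1 0%N w (addn0 _) (dist_refl w) y1 y2 y1w y2w wy1 wy2'.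
by rewrite /phi y2w1 dist_sym // w1y1 subn1 eqxx => /esym/eqP; clear; lia.
Qed.

(** Up to the middle of the graph the antipodal inequality gives
    2 alpha <= a1, hence a1 - alpha > r, and alpha grows by at least 1 at each
    step. *)
Lemma diameter_le : (D <= a1 + 2)%N.
Proof.
(* 2 j + 1 <= D says that D - 1 - j, the index antipodal to j, is at least j. *)
have half j : ((j + j).+1 <= D)%N -> 2 * al j <= a1%:R.
  move=> jD; have e : (j + (D - j.+1)).+1 = D by lia.
  have := alpha_antipodal e.
  have : al j <= al (D - j.+1)%N by apply: alpha_mono_le; lia.
  lra.
have grow j : ((j + j).+1 <= D)%N -> j%:R <= al j.
  elim: j => [|j IH] jD.
    by have [|n ->] := @alpha_nat 0; [lia | rewrite ler0n].
  have jD' : ((j + j).+1 <= D)%N by lia.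
  have h := half j jD'.
  have : al j < al j.+1 by apply: alpha_strict; [lia | move: r2; lra].
  have [|n nE] := @alpha_nat j; first lia.
  have [|m mE] := @alpha_nat j.+1; first lia.
  have := IH jD'; rewrite nE mE ler_nat ltr_nat ler_nat; lia.
have [D0|D0] := posnP D; first lia.
pose j := (D.-1)./2.
have je : D.-1 = (odd D.-1 + (j + j))%N by rewrite addnn odd_double_half.
have jD : ((j + j).+1 <= D)%N by lia.
have : (2 * j)%:R <= a1%:R :> R.
  by apply: le_trans (half j jD); rewrite natrM ler_wpM2l // grow.
rewrite ler_nat; case: (odd _) je => /=; lia.
Qed.

End TwoDependencies.
End EdgeCounts.

(** * Bounds on the parameters of a strongly regular graph *)

Section Ranks.
Variables (F : fieldType).
Local Open Scope ring_scope.

(** In a full rank factorization A = C B, the equation A A = c A gives B C = c. *)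
Lemma trace_scaled_idempotent (n : nat) (A : 'M[F]_n) (c : F) :
  A *m A = c *: A -> \tr A = c * (\rank A)%:R.
Proof.
move=> AA; rewrite -{1}(mulmx_base A) mxtrace_mulC.
suff -> : row_base A *m col_base A = c%:M by rewrite mxtrace_scalar mulr_natr.
apply: (row_free_inj (row_base_free A)).
have inj : injective (fun Y : 'M_(\rank A, n) => col_base A *m Y).
  move=> Y Z /(congr1 trmx) /=; rewrite trmx_mul [RHS]trmx_mul => h; apply: trmx_inj.
  have fr : row_free (col_base A)^T by rewrite /row_free mxrank_tr; apply: col_base_full.
  exact: (row_free_inj fr h).
apply: inj => /=.
rewrite mul_scalar_mx -scalemxAr mulmx_base (mulmxA (col_base A) _ (row_base A)).
by rewrite (mulmxA (col_base A) (row_base A)) mulmx_base -(mulmxA A) mulmx_base AA.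
Qed.

(** Multiplying two factorizations entrywise gives a factorization through the
    pairs of indices. *)
Lemma rank_hadamard (m n : nat) (A B : 'M[F]_(m, n)) :
  (\rank (\matrix_(i, j) (A i j * B i j)%R) <= \rank A * \rank B)%N.
Proof.
pose U : 'M_(m, \rank A * \rank B) := \matrix_(i, l)
  mxvec (\matrix_(a, b) (col_base A i a * col_base B i b)) 0 l.
pose V : 'M_(n, \rank A * \rank B) := \matrix_(j, l)
  mxvec (\matrix_(a, b) (row_base A a j * row_base B b j)) 0 l.
suff -> : \matrix_(i, j) (A i j * B i j) = U *m V^T by apply: mulmx_max_rank.
apply/matrixP => i j; rewrite !mxE -{1}(mulmx_base A) -{1}(mulmx_base B) !mxE.
rewrite (reindex _ (curry_mxvec_bij _ _)) /= big_distrlr pair_big /=.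
by apply: eq_bigr => [[a b] _]; rewrite !mxE !mxvecE !mxE mulrACA.
Qed.

End Ranks.

Section Multiplicity.
Variables (R : realType) (L : sgraph) (k l mu r m : nat).
Hypothesis srgL : srg L k l mu.
Hypothesis kE : k = mu + r * m.
Hypothesis lE : l + m = mu + r.
Hypothesis vE : mu * #|L| = (mu + r * m.-1) * (mu + m * r.+1).
Hypothesis m2 : 1 < m.
Hypothesis mu_gt0 : 0 < mu.
Local Open Scope ring_scope.
Local Notation X := (adjmx R L).
Local Notation J := (const_mx 1 : 'M[R]_#|L|).
Local Notation one := (const_mx 1 : 'cV[R]_#|L|).

Lemma srg_adjmx_sqr :
  X *m X = (k%:R - mu%:R)%:M + (l%:R - mu%:R) *: X + mu%:R *: J.
Proof.
have [reg cn] := srgL.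
apply/matrixP => i j; rewrite adjmx_sqr !mxE mulr1.
have [<-|ij] := eqVneq i j.
  by rewrite setIid reg adj_irrefl mulr1n mulr0 addr0 subrK.
rewrite mulr0n add0r cn ?(inj_eq enum_val_inj) //.
by case: (adj _ _); rewrite ?mulr1 ?mulr0 ?subrK ?add0r.
Qed.

Let Y : 'M[R]_#|L| := X + m%:R%:M.

Lemma srg_shift_sqr : Y *m Y = mu%:R *: J + (r + m)%:R *: Y.
Proof.
have kR : k%:R - mu%:R = r%:R * m%:R :> R by rewrite kE natrD natrM addrC addKr.
have lR : l%:R - mu%:R = r%:R - m%:R :> R.
  by apply/eqP; rewrite subr_eq addrAC eq_sym subr_eq -!natrD addnC -lE.
rewrite /Y mulmxDl !mulmxDr !(mul_mx_scalar, mul_scalar_mx) srg_adjmx_sqr kR lR.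
apply/matrixP => i j; rewrite !mxE natrD; case: (i == j); rewrite ?mulr1n ?mulr0n; ring.
Qed.

Lemma srg_shift_ones : Y *m J = (k + m)%:R *: J /\ J *m Y = (k + m)%:R *: J.
Proof.
have [reg _] := srgL; have oneX := adjmx_one R reg.
have Xone : one^T *m X = k%:R *: one^T.
  by apply: one_reg => //; apply: adjmx_sym.
rewrite all_onesE /Y natrD; split.
  by rewrite mulmxA mulmxDl oneX mul_scalar_mx -scalerDl -scalemxAl.
by rewrite -mulmxA mulmxDr Xone mul_mx_scalar -scalerDl -scalemxAr.
Qed.

Lemma srg_card_gt0 : (0 < #|L|)%N.
Proof.
have : (0 < mu * #|L|)%N by rewrite vE muln_gt0 !addn_gt0 mu_gt0.
by rewrite muln_gt0 => /andP[].
Qed.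

(** The multiplicity f of the eigenvalue r is the rank of a multiple of an
    idempotent, hence is read off its trace.  Since Y = X + m and Y - J have rank
    at most f + 1 and their entrywise product is a nonzero scalar matrix, the number of
    vertices is at most (f + 1)^2: a weak form of the absolute bound. *)
Lemma srg_multiplicity : exists f : nat,
  (((r + m) * f + k + m = m * #|L|) /\ (#|L| <= f.+1 ^ 2))%N.
Proof.
have v0 : #|L|%:R != 0 :> R by rewrite pnatr_eq0 -lt0n srg_card_gt0.
have [YJ JY] := srg_shift_ones.
pose c : R := (k + m)%:R / #|L|%:R.
pose E := Y - c *: J.
have JJ : J *m J = #|L|%:R *: J.
  by rewrite all_onesE mulmxA -[_ *m _ *m one]mulmxA one_one mul_mx_scalar -scalemxAl.
have cmu : mu%:R = c * (k%:R - r%:R).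
  rewrite /c mulrAC; apply: (canRL (mulfK v0)).
  have /(congr1 (fun n : nat => n%:R : R)) := vE.
  rewrite !natrM !natrD !natrM => ->; rewrite kE natrD natrM.
  rewrite -[in RHS](ltn_predK m2) -(ltn_predK m2) /=; move: m.-1 => n.
  by rewrite -!natr1; ring.
have EE : E *m E = (r + m)%:R *: E.
  rewrite /E mulmxBl !mulmxBr -!scalemxAl -!scalemxAr JJ YJ JY srg_shift_sqr.
  rewrite cmu; apply/matrixP => i j; rewrite !mxE.
  have ck : c * #|L|%:R = (k + m)%:R by rewrite /c divfK.
  have -> : c * (c * (#|L|%:R * 1)) = c * (k + m)%:R :> R by rewrite mulr1 ck.
  rewrite !natrD; ring.
exists (\rank E); split.
  have trE : \tr E = (m * #|L|)%:R - (k + m)%:R.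
    rewrite /E !linearB /= linearZ /= /Y linearD /= mxtrace_scalar.
    have -> : \tr X = 0 by rewrite /mxtrace big1 // => i _; rewrite adjmx_diag.
    have -> : \tr J = #|L|%:R.
      rewrite /mxtrace (eq_bigr (fun=> 1)); last by move=> i _; rewrite mxE.
      by rewrite sumr_const card_ord.
    by rewrite add0r /c divfK // -mulrnA.
  apply/eqP; rewrite -(eqr_nat R) -addnA natrD natrM -trace_scaled_idempotent //.
  by rewrite trE subrK eqxx.
pose H : 'M[R]_#|L| := \matrix_(i, j) (Y i j * (Y - J) i j).
have HE : H = (m * m.-1)%:R%:M.
  apply/matrixP => i j; rewrite !mxE; have [<-|ij] := eqVneq i j.
    rewrite adj_irrefl !mulr1n !add0r natrM; congr (_ * _).
    by rewrite -{1}(ltn_predK m2) -natr1 addrK.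
  by rewrite !mulr0n !addr0; case: (adj _ _); rewrite ?subrr ?mulr0 ?mul0r.
have rH : \rank H = #|L|.
  apply: mxrank_unit; rewrite HE unitmxE det_scalar unitrX // unitfE pnatr_eq0.
  by rewrite muln_eq0 negb_or; case: m m2 => [|[]].
have rE (a : R) : (\rank (E + a *: J)%R <= (\rank E).+1)%N.
  rewrite (leq_trans (mxrank_add _ _)) // -addn1 leq_add2l.
  by rewrite all_onesE scalemxAl mulmx_max_rank.
rewrite -{1}rH (leq_trans (rank_hadamard _ _)) // -mulnn leq_mul //.
  by have := rE c; rewrite /E subrK.
by have := rE (c - 1); rewrite /E scalerBl scale1r addrA subrK.
Qed.

End Multiplicity.

Section ParameterBounds.
Variables (v k mu r m f : nat).
Hypothesis kE : k = mu + r * m.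
Hypothesis vE : mu * v = (mu + r * m.-1) * (mu + m * r.+1).
Hypothesis fE : (r + m) * f + k + m = m * v.
Hypothesis vf : v <= f.+1 ^ 2.
Hypothesis mu2 : 2 * mu <= k.
Hypothesis mu_gt0 : 0 < mu.
Hypothesis r_gt0 : 0 < r.
Hypothesis m2 : 1 < m.

(** The multiplicity f is at most of order r m^3 / mu, while v is at least of
    order r^2 m / mu, so that v <= (f + 1)^2 bounds mu. *)
Lemma mu_bound : mu <= 144 * m ^ 5.
Proof.
have murm : mu <= r * m by move: mu2; rewrite kE; lia.
have m1 : m.-1 <= m by exact: leq_pred.
have vup : mu * v <= 6 * (r * m) ^ 2.
  rewrite vE (_ : 6 * _ = (2 * (r * m)) * (3 * (r * m))); last by ring.
  have h1 : r * m.-1 <= r * m by rewrite leq_mul2l m1 orbT.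
  have h2 : m <= r * m by rewrite leq_pmull.
  apply: leq_mul; first by move: murm h1; clear; lia.
  by rewrite mulnS [m * r]mulnC; move: murm h2; clear; lia.
have mf : mu * f <= 6 * r * m ^ 3.
  have : r * f <= m * v by rewrite -fE mulnDl; clear; lia.
  move=> /(leq_mul (leqnn mu)); rewrite mulnCA [mu * (m * v)]mulnCA => h.
  rewrite -(leq_pmul2l r_gt0) (leq_trans h) //.
  rewrite (_ : r * (6 * r * m ^ 3) = m * (6 * (r * m) ^ 2)); last by ring.
  by rewrite leq_mul2l vup orbT.
have f_gt0 : 0 < f.
  rewrite lt0n; apply/eqP => f0; move: vf; rewrite f0 /= => v1.
  have : m * v <= m by rewrite -{2}[m]muln1 leq_mul2l v1 orbT.
  by rewrite -fE f0 kE; move: mu_gt0; clear; lia.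
have v4 : v <= 4 * f ^ 2.
  apply: leq_trans vf _; rewrite (_ : 4 * f ^ 2 = (2 * f) ^ 2) ?leq_sqr; last by ring.
  by move: f_gt0; clear; lia.
have vlo : r ^ 2 * m <= mu * v.
  rewrite vE (_ : r ^ 2 * m = r * (m * r)); last by ring.
  have m11 : 1 <= m.-1 by move: m2; clear; lia.
  apply: leq_mul; last by rewrite mulnS; clear; lia.
  have : r <= r * m.-1 by rewrite leq_pmulr.
  by clear; lia.
have rm_gt0 : 0 < r ^ 2 * m by rewrite muln_gt0 expn_gt0 r_gt0 ltnW.
rewrite -(leq_pmul2r rm_gt0).
apply: leq_trans (leq_mul (leqnn mu) vlo) _.
apply: leq_trans (leq_mul (leqnn mu) (leq_mul (leqnn mu) v4)) _.
have := leq_mul mf mf; set t := _ * _ <= _ => h.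
rewrite (_ : mu * (mu * (4 * f ^ 2)) = 4 * (mu * f * (mu * f))); last by ring.
rewrite (_ : 144 * m ^ 5 * (r ^ 2 * m) = 4 * (6 * r * m ^ 3 * (6 * r * m ^ 3))); last by ring.
by rewrite leq_mul2l.
Qed.

(** Integrality of the multiplicity: modulo r + m, the equation for mu f reads
    (m - 1) (mu - m (m - 1)) (mu - m^2) = 0. *)
Lemma r_bound : mu != m ^ 2 -> mu != m * m.-1 -> r <= m * (mu + m ^ 2) ^ 2.
Proof.
move=> n1 n2.
have [n mE] : exists n, m = n.+1 by exists m.-1; rewrite (ltn_predK m2).
pose z : int := ((m%:Z - 1) * (mu%:Z - m%:Z * (m%:Z - 1)) * (mu%:Z - m%:Z ^+ 2))%R.
have z0 : z != 0%R.
  rewrite /z !mulf_neq0 //; apply/eqP => e; first by move: m2 e; clear; lia.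
    by move/eqP: n2; apply; move: e; rewrite mE /=; clear; lia.
  by move/eqP: n1; apply; move: e; rewrite -mulnn; clear; lia.
(* The polynomial in r that expresses mu f (r + m), minus its value at r = -m,
   is divisible by r + m; q is f mu minus the quotient. *)
pose q : int := (f%:Z * mu%:Z - (m%:Z ^+ 2 * (m%:Z - 1) * (r%:Z - m%:Z)
   + m%:Z * (mu%:Z * m%:Z + (m%:Z - 1) * (mu%:Z + m%:Z)) - mu%:Z * m%:Z))%R.
have zE : z = ((r%:Z + m%:Z) * q)%R.
  have e1 : (mu%:Z * v%:Z = (mu%:Z + r%:Z * (m%:Z - 1)) * (mu%:Z + m%:Z * (r%:Z + 1)))%R.
    move: vE; rewrite mE /= => /(congr1 Posz); rewrite !PoszM !PoszD !PoszM; clear; lia.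
  have e2 : ((r%:Z + m%:Z) * f%:Z + mu%:Z + r%:Z * m%:Z + m%:Z = m%:Z * v%:Z)%R.
    move: fE; rewrite kE => /(congr1 Posz); rewrite !PoszD !PoszM !PoszD; clear; lia.
  rewrite /z /q; move: e1 e2; clear.
  move: (Posz mu) (Posz r) (Posz m) (Posz v) (Posz f) => u a b c d e1 e2.
  have e3 : (u * ((a + b) * d + u + a * b + b) = b * (u * c))%R by rewrite e2; ring.
  rewrite e1 in e3.
  apply/eqP; rewrite -subr_eq0; apply/eqP.
  transitivity ((b * ((u + a * (b - 1)) * (u + b * (a + 1)))
     - u * ((a + b) * d + u + a * b + b))%R); first by ring.
  by rewrite e3 subrr.
have q1 : 1 <= `|q|%N.
  by rewrite lt0n absz_eq0; apply: contraNneq z0 => q0; rewrite zE q0 mulr0.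
have : r <= `|z|%N.
  rewrite zE abszM -PoszD absz_nat (leq_trans (leq_addr m r)) //.
  by rewrite leq_pmulr.
move=> h; apply: leq_trans h _; rewrite /z !abszM -mulnA.
have h1 : absz (m%:Z - 1)%R <= m by move: m2; clear; lia.
have h2 : absz (mu%:Z - m%:Z * (m%:Z - 1))%R <= mu + m ^ 2.
  by move: m2; clear; rewrite -mulnn; nia.
have h3 : absz (mu%:Z - m%:Z ^+ 2)%R <= mu + m ^ 2.
  by clear; rewrite -mulnn; nia.
by apply: leq_mul h1 _; rewrite -mulnn leq_mul.
Qed.

Lemma card_bound M B : mu <= M -> r <= B ->
  v <= (M + B * m) * (M + m * B.+1).
Proof.
move=> hM hB; apply: (@leq_trans (mu * v)); first by rewrite leq_pmull.
rewrite vE; apply: leq_mul; apply: leq_add => //; apply: leq_mul => //.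
exact: leq_pred.
Qed.

End ParameterBounds.

(** * The lines of a strongly regular graph with few common neighbours *)

Section UnionBounds.
Variables (I T : finType).
Implicit Types (A : {set I}) (S : I -> {set T}).

Lemma card_bigcup_le A S e : (forall i, i \in A -> #|S i| <= e) ->
  #|\bigcup_(i in A) S i| <= #|A| * e.
Proof.
move=> Se; rewrite -sum_nat_const.
apply: (@leq_trans (\sum_(i in A) #|S i|)); last exact: leq_sum.
elim/big_ind2: _ => [|U a V b Ua Vb|//]; first by rewrite cards0.
by apply: leq_trans (leq_add Ua Vb); rewrite -cardsUI leq_addr.
Qed.

(** A Bonferroni inequality, with the crude bound |A|^2 for the number of pairs. *)
Lemma card_bigcup_ge A S t e : (forall i, i \in A -> t <= #|S i|) ->
  (forall i j, i \in A -> j \in A -> i != j -> #|S i :&: S j| <= e) ->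
  #|A| * t <= #|\bigcup_(i in A) S i| + #|A| ^ 2 * e.
Proof.
move: {2}#|A| (erefl #|A|) => n; elim: n A => [|n IH] A An St Se.
  by rewrite An.
have /card_gt0P[i iA] : 0 < #|A| by rewrite An.
have A'n : #|A :\ i| = n by have := cardsD1 i A; rewrite iA An => -[].
have sub j : j \in A :\ i -> j \in A by rewrite inE => /andP[].
have := IH _ A'n (fun j jA => St j (sub j jA))
  (fun j j' jA j'A => Se j j' (sub j jA) (sub j' j'A)).
rewrite A'n => IHn; rewrite An (big_setD1 i) //=.
set U := \bigcup_(j in A :\ i) S j in IHn *.
have iU : #|S i :&: U| <= n * e.
  rewrite /U big_distrr /= -A'n; apply: card_bigcup_le => j jA.
  by apply: Se (sub j jA) _ => //; move: jA; rewrite !inE eq_sym => /andP[].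
have := cardsUI (S i) U; have := St i iA; rewrite mulSn.
move: IHn iU; clear; rewrite -!mulnn; nia.
Qed.

Lemma exists_subset_card (A : {set T}) n : n <= #|A| ->
  exists2 B : {set T}, B \subset A & #|B| = n.
Proof.
rewrite -bin_gt0 -cards_draws => /card_gt0P[B]; rewrite inE.
by case/andP => BA /eqP; exists B.
Qed.

End UnionBounds.

Section Lines.
Variables (L : sgraph) (k l mu r m : nat).
Hypothesis srgL : srg L k l mu.
Hypothesis kE : k = mu + r * m.
Hypothesis lE : l + m = mu + r.
Hypothesis m2 : 1 < m.
Hypothesis mu_le : mu <= m ^ 2.
Hypothesis r_large : 20 * m ^ 4 < r.
Implicit Types (x y z p w : L) (C Y : {set L}).

(* A lower bound for the size of the cliques found below; like l and k / m, it
   differs from r by a polynomial in m. *)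
Let t := l - m * mu.

(* The inequalities below are linear in these monomials, which are all small
   compared with r. *)
Let m_le : m <= m ^ 4. Proof. by rewrite -{1}[m]expn1 leq_pexp2l // ltnW. Qed.
Let mm_le : m * m <= m ^ 4.
Proof. by rewrite mulnn leq_pexp2l // ltnW. Qed.
Let mmu_le : m * mu <= m ^ 4.
Proof.
apply: (@leq_trans (m ^ 3)); last by rewrite leq_pexp2l // ltnW.
by rewrite expnS leq_mul.
Qed.
Let mu_le4 : mu <= m ^ 4.
Proof. by apply: leq_trans mu_le _; rewrite leq_pexp2l // ltnW. Qed.
Let mmmu_le : m * m * mu <= m ^ 4.
Proof. by rewrite (_ : m ^ 4 = m * m * m ^ 2) ?leq_mul //; ring. Qed.

Let tE : t + m + m * mu = mu + r.
Proof. by rewrite /t; move: lE mmu_le m_le r_large; clear; lia. Qed.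

Lemma no_large_claw : k + m.+1 ^ 2 * mu < m.+1 * l.+1.
Proof.
have e1 : m * l + m * m = m * mu + m * r by rewrite -!mulnDr lE.
move: m2 kE e1 lE m_le mm_le mmu_le mu_le4 mmmu_le r_large; clear.
rewrite -mulnn; lia.
Qed.
Lemma claw_exists : m.-1 * l.+1 < k.
Proof.
have mE := ltn_predK m2; set n := m.-1 in mE *.
have e1 : n * l + n * m = n * mu + n * r by rewrite -!mulnDr lE.
have e2 : n * r + r = r * m by rewrite -[in RHS]mE mulnS mulnC addnC.
have e3 : n * mu + mu = m * mu by rewrite -[in RHS]mE mulSn addnC.
rewrite kE mulnS; move: e1 e2 e3 mE m_le mmu_le r_large; clear; lia.
Qed.

Lemma few_lines : k + m.+1 ^ 2 * mu < m.+1 * t.-1.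
Proof.
have : 0 < t by move: tE m_le mmu_le r_large; clear; lia.
case: t tE => // t' tE' _ /=.
have e1 : m * t' + m + m * m + m * m * mu = m * mu + m * r.
  by rewrite -[in RHS]mulnDr -tE'; ring.
move: m2 kE e1 tE' m_le mm_le mmu_le mu_le4 mmmu_le r_large; clear.
rewrite -mulnn; lia.
Qed.

Lemma edge_on_line : m * mu + k + m ^ 2 * mu < l + m * t.-1.
Proof.
have : 0 < t by move: tE m_le mmu_le r_large; clear; lia.
case: t tE => // t' tE' _ /=.
have e1 : m * t' + m + m * m + m * m * mu = m * mu + m * r.
  by rewrite -[in RHS]mulnDr -tE'; ring.
move: m2 kE e1 tE' lE m_le mm_le mmu_le mu_le4 mmmu_le r_large; clear.
rewrite -mulnn; lia.
Qed.

Lemma line_unique_bound : l + 2 + mu < t + t.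
Proof. by move: m2 tE lE m_le mmu_le mu_le4 r_large; clear; lia. Qed.

Lemma line_size_bound : m ^ 2 < t.
Proof. by move: m2 tE m_le mm_le mmu_le mu_le4 r_large; clear; rewrite -mulnn; lia. Qed.

Definition clique C := [forall x in C, forall y in C, (x != y) ==> adj x y].
Definition coclique Y := [forall x in Y, forall y in Y, ~~ adj x y].

Lemma cliqueP C :
  reflect (forall x y, x \in C -> y \in C -> x != y -> adj x y) (clique C).
Proof.
apply: (iffP forall_inP) => [h x y xC yC|h x xC].
  by have /forall_inP/(_ y yC)/implyP := h x xC.
by apply/forall_inP => y yC; apply/implyP; apply: h.
Qed.

Lemma cocliqueP Y :
  reflect (forall x y, x \in Y -> y \in Y -> ~~ adj x y) (coclique Y).
Proof.
apply: (iffP forall_inP) => [h x y xC yC|h x xC].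
  by have /forall_inP := h x xC; apply.
by apply/forall_inP => y yC; apply: h.
Qed.

Let reg : regular_graph L k := srgL.1.

Lemma card_common_nonadj x y : x != y -> ~~ adj x y -> #|nbr x :&: nbr y| = mu.
Proof. by move=> xy nxy; rewrite srgL.2 // (negbTE nxy). Qed.

Lemma card_common_adj x y : adj x y -> #|nbr x :&: nbr y| = l.
Proof.
move=> xy; rewrite srgL.2 ?xy //; apply: contraTneq xy => ->.
by rewrite adj_irrefl.
Qed.

(** The vertices of a coclique of m + 1 neighbours of x would be adjacent to
    almost disjoint sets of about k / m neighbours of x. *)
Lemma card_coclique_le x Y : Y \subset nbr x -> coclique Y -> #|Y| <= m.
Proof.
move=> Yx /cocliqueP coY; rewrite leqNgt; apply/negP => /exists_subset_card[Z ZY Zm].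
have {}Yx z : z \in Z -> adj x z.
  by move=> /(subsetP ZY)/(subsetP Yx); rewrite inE.
have := @card_bigcup_ge _ _ Z (fun y => y |: (nbr x :&: nbr y)) l.+1 mu.
rewrite Zm => h; have := no_large_claw; rewrite ltnNge => /negP; apply.
apply: leq_trans (h _ _) _ => [y yZ|y z yZ zZ yz|].
- by rewrite cardsU1 !inE adj_irrefl andbF card_common_adj ?Yx.
- have nyz : ~~ adj y z by apply: coY; apply: (subsetP ZY).
  rewrite -(card_common_nonadj yz nyz); apply/subset_leq_card/subsetP => u.
  rewrite !inE => /andP[/orP[/eqP ->|/andP[_ yu]] /orP[/eqP uz|/andP[_ zu]]].
  + by rewrite uz eqxx in yz.
  + by rewrite adj_sym zu in nyz.
  + by rewrite -uz yu in nyz.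
  + by rewrite yu zu.
rewrite leq_add2r -(reg x); apply/subset_leq_card/bigcupsP => y yZ.
by apply/subsetP => u; rewrite !inE => /orP[/eqP ->|/andP[]//]; apply: Yx.
Qed.

(** A maximal coclique in the neighbourhood of x dominates it, which fewer than
    m vertices cannot do. *)
Lemma exists_coclique x : exists Y,
  [/\ Y \subset nbr x, coclique Y & #|Y| = m].
Proof.
have [|Y /maxsetP[/andP[Yx coY] Ymax]] :=
    @ex_maxset _ (fun Y => (Y \subset nbr x) && coclique Y).
  by exists set0; rewrite sub0set; apply/cocliqueP => y z; rewrite inE.
exists Y; split=> //; apply/eqP; rewrite eqn_leq (card_coclique_le Yx) //=.
rewrite leqNgt; apply/negP => Ym.
have cov : nbr x \subset \bigcup_(y in Y) (y |: (nbr x :&: nbr y)).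
  apply/subsetP => z xz; apply/bigcupP.
  have [zY|zY] := boolP (z \in Y); first by exists z; rewrite // !inE eqxx.
  have [/existsP[y /andP[yY yz]]|] := boolP [exists y, (y \in Y) && adj y z].
    by exists y => //; move: xz; rewrite !inE yz => ->; rewrite orbT.
  rewrite negb_exists => /forallP none.
  have nadj y : y \in Y -> ~~ adj y z by have := none y; case: (y \in Y).
  have YE : z |: Y = Y.
    apply: Ymax; last exact: subsetUr.
    rewrite subUset sub1set xz Yx; apply/cocliqueP => u v.
    rewrite !inE => /orP[/eqP ->|uY] /orP[/eqP ->|vY].
    + by rewrite adj_irrefl.
    + by rewrite adj_sym nadj.
    + exact: nadj.
    + by move/cocliqueP: coY; apply.
  by rewrite -YE !inE eqxx in zY.
have := leq_trans (subset_leq_card cov) (@card_bigcup_le _ _ Y _ l.+1 _).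
rewrite reg => h; have := claw_exists; rewrite ltnNge => /negP; apply.
apply: leq_trans (h _) _.
  move=> y yY; have xy : adj x y by have := subsetP Yx y yY; rewrite inE.
  by rewrite cardsU1 !inE adj_irrefl andbF card_common_adj.
by rewrite leq_mul2r -ltnS (ltn_predK m2) Ym orbT.
Qed.

(** When Y is a coclique of m neighbours of x, these sets are cliques through x
    that together cover almost all its neighbours. *)
Definition sheaf x Y y : {set L} :=
  x |: [set z in nbr x | [forall y' in Y, (y' != y) ==> (z != y') && ~~ adj z y']].

Lemma sheaf_nbr x Y y z : z \in nbr x ->
  (forall y', y' \in Y -> y' != y -> z != y' /\ ~~ adj z y') ->
  z \in sheaf x Y y.
Proof.
move=> xz h; rewrite 3!inE xz; apply/orP; right; apply/forall_inP => y' yY.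
by apply/implyP => yy; have [-> ->] := h y' yY yy.
Qed.

Lemma sheafP x Y y z : z \in sheaf x Y y -> z != x ->
  adj x z /\ forall y', y' \in Y -> y' != y -> z != y' /\ ~~ adj z y'.
Proof.
rewrite !inE => /orP[/eqP ->|/andP[xz /forall_inP h _]]; first by rewrite eqxx.
split=> // y' yY yy; have := h y' yY; rewrite yy /=.
by case/andP.
Qed.

Section Sheaves.
Variables (x : L) (Y : {set L}).
Hypothesis Yx : Y \subset nbr x.
Hypothesis coY : coclique Y.
Hypothesis Ym : #|Y| = m.

Let xY y : y \in Y -> adj x y.
Proof. by move=> /(subsetP Yx); rewrite inE. Qed.

(** Exchanging y for two nonadjacent vertices of its sheaf would give a coclique
    of size m + 1. *)
Lemma sheaf_clique y : y \in Y -> clique (sheaf x Y y).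
Proof.
move=> yY; apply/cliqueP => u v uS vS uv.
have [ux|ux] := eqVneq u x.
  by rewrite ux in uv *; have [] := sheafP vS; rewrite // eq_sym.
have [vx|vx] := eqVneq v x; first by rewrite vx adj_sym; have [] := sheafP uS.
apply: contraT => nuv; have [xu hu] := sheafP uS ux; have [xv hv] := sheafP vS vx.
have uY : u \notin Y :\ y.
  by apply/negP; rewrite !inE => /andP[uy uY]; have [] := hu u uY uy; rewrite eqxx.
have vY : v \notin Y :\ y.
  by apply/negP; rewrite !inE => /andP[vy vY]; have [] := hv v vY vy; rewrite eqxx.
have : #|u |: (v |: Y :\ y)| <= m.
  apply: (@card_coclique_le x).
    rewrite !subUset !sub1set !inE xu xv; apply: subset_trans Yx.
    exact: subsetDl.
  apply/cocliqueP => a b.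
  have nY c d : c \in Y :\ y -> (d == u) || (d == v) -> ~~ adj d c.
    rewrite !inE => /andP[cy cY] /orP[]/eqP ->; first by have [] := hu c cY cy.
    by have [] := hv c cY cy.
  rewrite !in_setU1.
  case/or3P => [/eqP ->|/eqP ->|aY]; case/or3P => [/eqP ->|/eqP ->|bY].
  - by rewrite adj_irrefl.
  - by [].
  - by apply: nY => //; rewrite eqxx.
  - by rewrite adj_sym.
  - by rewrite adj_irrefl.
  - by apply: nY => //; rewrite eqxx orbT.
  - by rewrite adj_sym; apply: nY => //; rewrite eqxx.
  - by rewrite adj_sym; apply: nY => //; rewrite eqxx orbT.
  - by move/cocliqueP: coY; apply; [move: aY | move: bY]; rewrite inE => /andP[].
rewrite cardsU1 in_setU1 (negbTE uv) (negbTE uY) /= cardsU1 vY.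
by have := cardsD1 y Y; rewrite yY Ym => ->; rewrite ltnn.
Qed.

Lemma mem_sheaf y : y \in Y -> y \in sheaf x Y y.
Proof.
move=> yY; apply: sheaf_nbr; first by rewrite inE xY.
move=> y' y'Y ne; rewrite eq_sym ne; split=> //.
by move/cocliqueP: coY; apply.
Qed.

Lemma card_sheaf y : y \in Y -> t <= #|sheaf x Y y|.
Proof.
move=> yY; have ly := card_common_adj (xY yY).
have sub : nbr x :&: nbr y \subset
    sheaf x Y y :|: \bigcup_(y' in Y :\ y) (nbr y :&: nbr y').
  apply/subsetP => z; rewrite in_setI => /andP[xz yz].
  rewrite in_setU; have [//|/=] := boolP (z \in sheaf x Y y).
  apply: contraNT => /bigcupP none; apply: sheaf_nbr => // y' y'Y ne; split.
    apply: contraTneq yz => ->; rewrite inE.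
    by move/cocliqueP: coY; apply.
  apply/negP => zy'; apply: none; exists y'; first by rewrite !inE ne y'Y.
  by rewrite in_setI yz inE adj_sym.
have := subset_leq_card sub; rewrite ly => h.
rewrite /t leq_subLR; apply: leq_trans h _.
apply: leq_trans (leq_card_setU _ _) _; rewrite addnC leq_add2r.
apply: leq_trans (@card_bigcup_le _ _ _ _ mu _) _; last first.
  by rewrite leq_mul2r -Ym subset_leq_card ?orbT // subsetDl.
move=> y'; rewrite !inE => /andP[ne y'Y]; rewrite card_common_nonadj // 1?eq_sym //.
by move/cocliqueP: coY; apply.
Qed.

End Sheaves.

(** In a geometry with m lines on each point and k neighbours of each point,
    the lines would be cliques of size 1 + k / m; the bound t is slightly
    smaller. *)
Definition lines : {set {set L}} := [set C | maxset clique C && (t <= #|C|)].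

Lemma line_clique C : C \in lines -> clique C.
Proof. by rewrite inE => /andP[/maxsetp]. Qed.

Lemma line_maximal C p : C \in lines -> p \notin C ->
  exists2 w, w \in C & ~~ adj p w.
Proof.
rewrite inE => /andP[/maxsetP[/cliqueP cC Cmax] _] pC.
have [/existsP[w /andP[wC pw]]|] := boolP [exists w, (w \in C) && ~~ adj p w].
  by exists w.
rewrite negb_exists => /forallP all.
have pall w : w \in C -> adj p w by have := all w; case: (w \in C) => //= /negPn.
have CE : p |: C = C.
  apply: Cmax; last exact: subsetUr.
  apply/cliqueP => u v; rewrite !inE => /orP[/eqP ->|uC] /orP[/eqP ->|vC] uv.
  + by rewrite eqxx in uv.
  + exact: pall.
  + by rewrite adj_sym pall.
  + exact: cC.
by rewrite -CE !inE eqxx in pC.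
Qed.

Lemma card_nbr_line C p : C \in lines -> p \notin C -> #|nbr p :&: C| <= mu.
Proof.
move=> Cl pC; have [w wC pw] := line_maximal Cl pC.
have pw' : p != w by apply: contraNneq pC => ->.
rewrite -(card_common_nonadj pw' pw); apply/subset_leq_card/subsetP => u.
rewrite !inE => /andP[pu uC]; rewrite pu /=.
have /cliqueP := line_clique Cl; apply=> //.
by apply: contraNneq pw => ->.
Qed.

Lemma card_two_lines C C' : C \in lines -> C' \in lines -> C != C' ->
  #|C :&: C'| <= mu.
Proof.
move=> Cl C'l ne.
have [/subsetP CC'|/subsetPn[z zC zC']] := boolP (C \subset C').
  case/eqP: ne; apply/esym; move: (Cl); rewrite inE => /andP[/maxsetP[_ Cmax] _].
  by apply: Cmax; [exact: line_clique | apply/subsetP].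
apply: leq_trans (card_nbr_line C'l zC'); apply/subset_leq_card/subsetP => u.
rewrite !inE => /andP[uC uC']; rewrite uC' andbT.
have /cliqueP := line_clique Cl; apply=> //.
by apply: contraNneq zC' => ->.
Qed.

Lemma line_size C : C \in lines -> m ^ 2 < #|C|.
Proof. by rewrite inE => /andP[_]; apply: leq_trans line_size_bound. Qed.

(** Lines through x share few points, so that they cover disjoint sets of
    neighbours of x up to a bounded error. *)
Lemma card_line_bigcup x (A : {set {set L}}) :
  A \subset [set C in lines | x \in C] ->
  #|A| * t.-1 <= #|\bigcup_(C in A) (C :\ x)| + #|A| ^ 2 * mu.
Proof.
move=> /subsetP Ax; apply: card_bigcup_ge => [C /Ax|C C' /Ax + /Ax].
  rewrite inE => /andP[Cl xC]; have := cardsD1 x C; rewrite xC add1n.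
  by move: Cl; rewrite inE => /andP[_ tC] h; rewrite h in tC; case: t tC.
rewrite !inE => /andP[Cl _] /andP[C'l _] ne.
apply: leq_trans (card_two_lines (C := C) (C' := C') _ _ ne); rewrite ?inE //.
by apply/subset_leq_card/subsetP => u; rewrite !inE => /andP[/andP[_ ->] /andP[_ ->]].
Qed.

Lemma line_bigcup_nbr x (A : {set {set L}}) :
  A \subset [set C in lines | x \in C] ->
  \bigcup_(C in A) (C :\ x) \subset nbr x.
Proof.
move=> /subsetP Ax; apply/bigcupsP => C /Ax; rewrite inE => /andP[Cl xC].
apply/subsetP => u; rewrite !inE => /andP[ux uC].
by have /cliqueP := line_clique Cl; apply; rewrite // eq_sym.
Qed.

Lemma card_lines_le x : #|[set C in lines | x \in C]| <= m.
Proof.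
rewrite leqNgt; apply/negP => /exists_subset_card[A Ax Am].
have := card_line_bigcup Ax; rewrite Am => h.
have := few_lines; rewrite ltnNge => /negP; apply; apply: leq_trans h _.
by rewrite leq_add2r -(reg x) subset_leq_card // line_bigcup_nbr.
Qed.

(** The m sheaves of a maximal coclique extend to different lines. *)
Lemma card_lines x : #|[set C in lines | x \in C]| = m.
Proof.
apply/eqP; rewrite eqn_leq card_lines_le /=.
have [Y [Yx coY Ym]] := exists_coclique x.
pose g y := odflt set0 [pick C in lines | sheaf x Y y \subset C].
have gP y : y \in Y -> g y \in lines /\ sheaf x Y y \subset g y.
  move=> yY; rewrite /g; case: pickP => [C /andP[]//|none].
  have [C Cmax sC] := maxset_exists (sheaf_clique Yx coY Ym yY).
  have := none C; rewrite inE Cmax sC andbT /= => /negP[].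
  exact: leq_trans (card_sheaf Yx coY Ym yY) (subset_leq_card sC).
rewrite -Ym -(card_in_imset (f := g)).
  apply/subset_leq_card/subsetP => _ /imsetP[y yY ->].
  have [gl gs] := gP y yY; rewrite inE gl (subsetP gs) //.
  by rewrite !inE eqxx.
move=> y z yY zY gyz; apply: contraTeq isT => yz.
have [gl gs] := gP y yY; have [_ gs'] := gP z zY.
have yg : y \in g y by apply: (subsetP gs); apply: mem_sheaf.
have zg : z \in g y by rewrite gyz; apply: (subsetP gs'); apply: mem_sheaf.
have := elimT (cliqueP _) (line_clique gl) y z yg zg yz.
by rewrite (negbTE (elimT (cocliqueP _) coY y z yY zY)).
Qed.

(** If no line contained x and y, then y would have few neighbours on each of
    the lines through x, and these lines cover almost all neighbours of x. *)
Lemma edge_line x y : adj x y -> exists C, [/\ C \in lines, x \in C & y \in C].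
Proof.
move=> xy; pose A := [set C in lines | x \in C].
have [/existsP[C /and3P[Cl xC yC]]|] :=
  boolP [exists C, [&& C \in lines, x \in C & y \in C]]; first by exists C.
rewrite negb_exists => /forallP none; exfalso.
have yA C : C \in A -> y \notin C.
  by rewrite inE => /andP[Cl xC]; have := none C; rewrite Cl xC.
pose U := \bigcup_(C in A) (C :\ x).
have Ux : U \subset nbr x by apply: line_bigcup_nbr.
have := card_line_bigcup (subxx A); rewrite -/U card_lines => hU.
have sub : nbr x :&: nbr y \subset
    (nbr x :\: U) :|: \bigcup_(C in A) (nbr y :&: C).
  apply/subsetP => u; rewrite in_setI in_setU in_setD => /andP[-> yu]; rewrite andbT.
  have [uU|//] := boolP (u \in U); apply/bigcupP.
  have /bigcupP[C CA] := uU; rewrite inE => /andP[_ uC].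
  by exists C => //; rewrite in_setI yu.
have := leq_trans (subset_leq_card sub) (leq_card_setU _ _).
rewrite (card_common_adj xy) cardsDS // reg => h1.
have h2 : #|\bigcup_(C in A) (nbr y :&: C)| <= m * mu.
  rewrite -{1}(card_lines x); apply: card_bigcup_le => C CA.
  by apply: card_nbr_line (yA C CA); move: CA; rewrite inE => /andP[].
have := subset_leq_card Ux; rewrite reg; move: hU h1 h2 edge_on_line.
by clear; lia.
Qed.

(** Two lines through an edge would consist almost entirely of common neighbours
    of its ends, and have about 2 k / m points, whereas l is about k / m. *)
Lemma line_unique C C' x y : C \in lines -> C' \in lines -> x != y ->
  x \in C -> y \in C -> x \in C' -> y \in C' -> C = C'.
Proof.
move=> Cl C'l xy xC yC xC' yC'; apply: contraTeq isT => ne.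
have cC := elimT (cliqueP _) (line_clique Cl).
have cC' := elimT (cliqueP _) (line_clique C'l).
have axy : adj x y by apply: cC.
have sub : C :|: C' \subset x |: (y |: (nbr x :&: nbr y)).
  apply/subsetP => u uCC; rewrite !inE.
  have [//|ux] := eqVneq u x; have [//|uy] := eqVneq u y.
  move: uCC; rewrite inE /= => /orP[uC|uC'].
    by rewrite !cC // eq_sym.
  by rewrite !cC' // eq_sym.
have h1 : #|C :|: C'| <= l + 2.
  apply: leq_trans (subset_leq_card sub) _.
  rewrite cardsU1 !inE adj_irrefl (negbTE xy) cardsU1 !inE adj_irrefl andbF.
  by rewrite card_common_adj //; clear; lia.
have := cardsUI C C'; have := card_two_lines Cl C'l ne.
move: Cl C'l; rewrite !inE => /andP[_ tC] /andP[_ tC'].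
by move: h1 tC tC' line_unique_bound; clear; lia.
Qed.

End Lines.

(** * Partial linear spaces: block graphs of Steiner systems and arrays *)

Section LinearSpace.
Variables (L : sgraph) (k l mu m : nat) (Ls : {set {set L}}).
Hypothesis srgL : srg L k l mu.
Hypothesis m2 : 1 < m.
Hypothesis Ls_clique : forall (C : {set L}) (x y : L),
  C \in Ls -> x \in C -> y \in C -> x != y -> adj x y.
Hypothesis Ls_maximal : forall (C : {set L}) (p : L),
  C \in Ls -> p \notin C -> exists2 w, w \in C & ~~ adj p w.
Hypothesis Ls_edge : forall x y : L,
  adj x y -> exists C, [/\ C \in Ls, x \in C & y \in C].
Hypothesis Ls_unique : forall (C C' : {set L}) (x y : L),
  C \in Ls -> C' \in Ls -> x != y ->
  x \in C -> y \in C -> x \in C' -> y \in C' -> C = C'.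
Hypothesis Ls_card : forall x : L, #|[set C in Ls | x \in C]| = m.
Implicit Types (C : {set L}) (x y z p w : L).

Lemma adj_neq x y : adj x y -> x != y.
Proof. by apply: contraTneq => ->; rewrite adj_irrefl. Qed.

(** Joining p to its neighbours on C identifies them with the lines through p
    that meet C, as no two of them are on a line through p. *)
Lemma nbr_line_meet C p : C \in Ls -> p \notin C ->
  #|nbr p :&: C| = #|[set C' in Ls | (p \in C') && (C' :&: C != set0)]|.
Proof.
move=> Cl pC.
pose g z := odflt set0 [pick C' in Ls | (p \in C') && (z \in C')].
have gP z : adj p z -> [/\ g z \in Ls, p \in g z & z \in g z].
  move=> pz; rewrite /g; case: pickP => [C' /and3P[]//|none].
  by have [C' [C'l pC' zC']] := Ls_edge pz; have := none C'; rewrite C'l pC' zC'.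
rewrite -(card_in_imset (f := g)); last first.
  move=> z z'; rewrite !inE => /andP[pz zC] /andP[pz' z'C] e.
  have [gl pg zg] := gP z pz; have [_ _] := gP z' pz'; rewrite -e => z'g.
  apply: contraNeq pC => zz'.
  by rewrite -(Ls_unique gl Cl zz' zg z'g zC z'C).
apply: eq_card => C'; apply/imsetP/idP.
  move=> [z]; rewrite !inE => /andP[pz zC] ->; have [-> -> zg] := gP z pz.
  by apply/set0Pn; exists z; rewrite inE zg.
rewrite inE => /and3P[C'l pC' /set0Pn[z]]; rewrite inE => /andP[zC' zC].
have pz : p != z by apply: contraNneq pC => ->.
have apz : adj p z by apply: (Ls_clique C'l) pz.
exists z; first by rewrite in_setI zC inE apz.
by have [gl pg zg] := gP z apz; apply: (Ls_unique C'l gl pz).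
Qed.

Lemma card_nbr_line_le C p : C \in Ls -> p \notin C -> #|nbr p :&: C| <= m.
Proof.
move=> Cl pC; rewrite nbr_line_meet // -(Ls_card p).
by apply/subset_leq_card/subsetP => C'; rewrite !inE => /and3P[-> ->].
Qed.

Lemma two_lines_meet_le1 C C' : C \in Ls -> C' \in Ls -> C != C' ->
  #|C :&: C'| <= 1.
Proof.
move=> Cl C'l ne; apply/card_le1_eqP => x y.
rewrite !inE => /andP[xC xC'] /andP[yC yC']; apply: contraNeq ne => xy.
by rewrite (Ls_unique Cl C'l (x := y) (y := x)) // 1?eq_sym.
Qed.

Lemma card_lines_through x y : x != y ->
  #|[set C in Ls | (x \in C) && (y \in C)]| = (adj x y : nat).
Proof.
move=> xy; case axy : (adj x y).
  have [C [Cl xC yC]] := Ls_edge axy.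
  apply/eqP/cards1P; exists C; apply/setP => C'; rewrite !inE.
  apply/idP/eqP => [/and3P[C'l xC' yC']|->]; last by rewrite Cl xC.
  exact: (Ls_unique C'l Cl xy).
apply/eqP; rewrite cards_eq0; apply/eqP/setP => C'; rewrite !inE; apply/negP.
by move=> /and3P[C'l xC' yC']; have := Ls_clique C'l xC' yC' xy; rewrite axy.
Qed.

(** Every common neighbour of p and z is on exactly one line through z. *)
Lemma sum_nbr_lines p z : p != z -> ~~ adj p z ->
  \sum_(C in Ls | z \in C) #|nbr p :&: C| = mu.
Proof.
move=> pz npz; have := srgL.2 p z pz; rewrite (negbTE npz) => <-.
transitivity (\sum_(C in Ls | z \in C) \sum_(u in nbr p) (u \in C : nat)).
  apply: eq_bigr => C _; rewrite -sum1_card [LHS]big_mkcond [RHS]big_mkcond.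
  by apply: eq_bigr => u _; rewrite in_setI; case: (u \in nbr p); case: (u \in C).
rewrite exchange_big -sum1_card [RHS]big_mkcond [LHS]big_mkcond /=.
apply: eq_bigr => u _; rewrite in_setI; case pu : (u \in nbr p) => //=.
have zu : z != u by apply: contraNneq npz => ->; move: pu; rewrite inE.
rewrite [in RHS]inE (_ : (if adj z u then 1 else 0) = (adj z u : nat)) //.
rewrite -(card_lines_through zu) -sum1_card big_mkcond [RHS]big_mkcond /=.
apply: eq_bigr => C _; rewrite inE.
by case: (C \in Ls); case: (z \in C); case: (u \in C).
Qed.

Section Steiner.
Hypothesis muE : mu = m ^ 2.

(** A vertex off a line has at most m neighbours on it.  For mu = m^2 the sum
    over the m lines through z leaves no room, so that all lines meet. *)
Lemma lines_meet C C' : C \in Ls -> C' \in Ls -> C != C' ->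
  exists2 x, x \in C & x \in C'.
Proof.
move=> Cl C'l ne.
have [p pC pC'] : exists2 p, p \in C & p \notin C'.
  apply/subsetPn; apply: contraNN ne => sub; rewrite eqEsubset sub /=.
  apply/subsetP => w wC'; apply: contraT => wC.
  have [u uC wu] := Ls_maximal Cl wC; have uC' := subsetP sub u uC.
  case/negP: wu; apply: Ls_clique C'l wC' uC' _.
  by apply: contraNneq wC => ->.
have [w wC' npw] := Ls_maximal C'l pC'.
have pw : p != w by apply: contraNneq pC' => ->.
have full : #|nbr p :&: C'| = m.
  apply/eqP; rewrite eqn_leq card_nbr_line_le //= leqNgt; apply/negP => lt.
  have := sum_nbr_lines pw npw; rewrite muE (bigD1 C') ?C'l //= => e.
  have : \sum_(i in Ls | (w \in i) && (i != C')) #|nbr p :&: i| <= m.-1 * m.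
    have cE : #|[set D in Ls | (w \in D) && (D != C')]| = m.-1.
      rewrite -(Ls_card w) (cardsD1 C' [set C in Ls | w \in C]) !inE C'l wC' /=.
      apply: eq_card => D; rewrite !inE.
      by case: (D \in Ls); case: (w \in D); case: eqP.
    rewrite -cE -sum_nat_const; apply: (@leq_trans (\sum_(i in Ls | (w \in i) && (i != C')) m)).
      apply: leq_sum => D /and3P[Dl wD _]; apply: card_nbr_line_le => //.
      by apply: contraNN npw => pD; apply: Ls_clique Dl pD wD pw.
    by apply/eq_leq/eq_bigl => D; rewrite inE.
  move=> le; move: e; set S := (X in _ + X = _) => e.
  have leS : S <= m.-1 * m.
    by apply: leq_trans le; apply/eq_leq/eq_bigl => D; rewrite andbA.
  have mm : m * m = m + m.-1 * m by rewrite -{1}(ltn_predK m2) mulSn.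
  by move: e lt leS; rewrite -mulnn mm; clear; lia.
have : C \in [set D in Ls | (p \in D) && (D :&: C' != set0)].
  suff -> : [set D in Ls | (p \in D) && (D :&: C' != set0)] = [set D in Ls | p \in D].
    by rewrite inE Cl.
  apply/eqP; rewrite eqEcard Ls_card -nbr_line_meet // full leqnn andbT.
  by apply/subsetP => D; rewrite !inE => /and3P[-> ->].
rewrite inE => /and3P[_ _ /set0Pn[x]]; rewrite inE => /andP[xC xC'].
by exists x.
Qed.

(** The lines are the points of the Steiner system, and a vertex is the block of
    the lines on it. *)
Lemma steiner_block_graph_of_lines : is_steiner_block_graph L.
Proof.
pose b x : {set 'I_#|Ls|} := [set i : 'I_#|Ls| | x \in (enum_val i : {set L})].
pose Bs := b @: [set: L].
have bcard x y : #|b x :&: b y| = #|[set C in Ls | (x \in C) && (y \in C)]|.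
  rewrite -(card_imset _ (@enum_val_inj _ (mem Ls))).
  apply: eq_card => C; apply/imsetP/idP.
    by move=> [i]; rewrite !inE => /andP[xi yi] ->; rewrite enum_valP xi yi.
  rewrite inE => /and3P[Cl xC yC]; exists (enum_rank_in Cl C).
    by rewrite !inE enum_rankK_in ?xC.
  by rewrite enum_rankK_in.
have bxx x : #|b x| = m.
  rewrite -[b x]setIid bcard -(Ls_card x); apply: eq_card => C.
  by rewrite !inE andbb.
have binj : injective b.
  move=> x y e; apply: contraTeq m2 => xy; rewrite -leqNgt.
  have := bcard x y; rewrite e setIid bxx => ->.
  by rewrite card_lines_through //; case: (adj x y).
have bB x : b x \in Bs by apply: imset_f.
exists m, #|Ls|, Bs; split.
  split=> [B /imsetP[x _ ->]|i j ij]; first exact: bxx.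
  have ne : enum_val i != enum_val j by rewrite (inj_eq enum_val_inj).
  have [x xi xj] := lines_meet (enum_valP i) (enum_valP j) ne.
  apply/eqP/cards1P; exists (b x); apply/setP => B; rewrite !inE.
  apply/idP/eqP => [/and3P[/imsetP[y _ ->]]|->]; last by rewrite bB !inE xi.
  rewrite !inE => yi yj; congr b; apply: contraNeq ne => yx.
  by rewrite (Ls_unique (enum_valP i) (enum_valP j) yx).
pose f x : steiner_block_graph Bs := exist _ (b x) (bB x).
have finj : injective f by move=> x y /(congr1 val) /binj.
exists f; split.
  apply: inj_card_bij => //.
  by rewrite card_sig /= (card_imset _ binj) cardsT.
move=> x y; rewrite /= /steiner_adj (inj_eq finj) /=.
have [<-|xy] := eqVneq x y; first by rewrite adj_irrefl.
by rewrite bcard card_lines_through //; case: (adj x y).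
Qed.

End Steiner.

Section Array.
Variable n : nat.
Hypothesis muE : mu = m * m.-1.
Hypothesis kE : k + m = m * n.
Hypothesis lE : l + 2 * m = mu + n.
Hypothesis vE : #|L| = n ^ 2.
Hypothesis Ls_size : forall C, C \in Ls -> m ^ 2 < #|C|.

Let reg : regular_graph L k := srgL.1.

Lemma card_nbr_in_line C p : C \in Ls -> p \in C -> (#|nbr p :&: C|).+1 = #|C|.
Proof.
move=> Cl pC; rewrite (cardsD1 p C) pC; congr (_.+1); apply: eq_card => z.
rewrite !inE andbC [RHS]andbC; case zC : (z \in C) => //=.
have [->|zp] := eqVneq z p; first by rewrite adj_irrefl.
by rewrite (Ls_clique Cl pC zC) // eq_sym.
Qed.

Lemma line_degree_sum C : C \in Ls -> \sum_p #|nbr p :&: C| = #|C| * k.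
Proof.
move=> Cl; transitivity (\sum_p \sum_(z in C) (adj p z : nat)).
  apply: eq_bigr => p _; rewrite -sum1_card [LHS]big_mkcond [RHS]big_mkcond /=.
  by apply: eq_bigr => z _; rewrite !inE; case: (adj p z); case: (z \in C).
rewrite exchange_big -sum_nat_const; apply: eq_bigr => z _.
rewrite -(reg z) -sum1_card [RHS]big_mkcond /=.
by apply: eq_bigr => p _; rewrite inE adj_sym; case: (adj z p).
Qed.

Lemma line_degree_sqr_sum C : C \in Ls ->
  \sum_p #|nbr p :&: C| ^ 2 = #|C| * (k + #|C|.-1 * l).
Proof.
move=> Cl.
transitivity (\sum_p \sum_(z in C) \sum_(z' in C) (adj p z && adj p z' : nat)).
  apply: eq_bigr => p _.
  have cE : #|nbr p :&: C| = \sum_(z in C) (adj p z : nat).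
    rewrite -sum1_card [LHS]big_mkcond [RHS]big_mkcond /=.
    by apply: eq_bigr => z _; rewrite !inE; case: (adj p z); case: (z \in C).
  rewrite -mulnn {1 2}cE big_distrlr /=.
  by apply: eq_bigr => z _; apply: eq_bigr => z' _; rewrite mulnb.
rewrite exchange_big -sum_nat_const; apply: eq_bigr => z zC.
rewrite exchange_big /= (bigD1 z) //=; congr (_ + _).
  rewrite -(reg z) -sum1_card [RHS]big_mkcond /=.
  by apply: eq_bigr => p _; rewrite inE andbb adj_sym; case: (adj z p).
have -> : #|C|.-1 = #|C :\ z| by rewrite (cardsD1 z C) zC.
rewrite -sum_nat_const; apply: eq_big => z'; first by rewrite !inE andbC.
move=> /andP[z'C ne]; have az : adj z z' by apply: (Ls_clique Cl) => //; rewrite eq_sym.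
have := srgL.2 z z'; rewrite az eq_sym => /(_ ne) <-.
rewrite -sum1_card [RHS]big_mkcond /=; apply: eq_bigr => p _.
by rewrite !inE ![adj _ p]adj_sym; case: (adj p z); case: (adj p z').
Qed.

(** The deviations from m - 1 of the numbers of neighbours on C have a sum of
    squares with the factor n - c, where c = #|C|; the other factor is positive
    for c > m (m - 1).  Hence c <= n, and all deviations vanish if c = n. *)
Lemma line_variance C : C \in Ls ->
  (\sum_(p | p \notin C) ((#|nbr p :&: C|)%:Z - (m%:Z - 1)) ^+ 2 =
  (n%:Z - #|C|%:Z) *
    (#|C|%:Z ^+ 2 - m%:Z * (m%:Z - 1) * #|C|%:Z + (m%:Z - 1) ^+ 2 * n%:Z))%R.
Proof.
move=> Cl; set c := #|C|.
have c_gt0 : 0 < c by rewrite (leq_trans _ (Ls_size Cl)).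
have tot : (\sum_p ((#|nbr p :&: C|)%:Z - (m%:Z - 1)) ^+ 2 =
    (c * (k + c.-1 * l))%:Z - 2 * (m%:Z - 1) * (c * k)%:Z + (m%:Z - 1) ^+ 2 * (n ^ 2)%:Z)%R.
  rewrite -(line_degree_sum Cl) -(line_degree_sqr_sum Cl) -vE.
  rewrite !(big_morph Posz PoszD (erefl _)) big_distrr /=.
  have -> : (#|L|%:Z = \sum_(p : L) 1)%R by rewrite sumr_const natz.
  rewrite big_distrr /= -sumrB -big_split /=; apply: eq_bigr => p _.
  by rewrite -mulnn PoszM; ring.
have ins : (\sum_(p in C) ((#|nbr p :&: C|)%:Z - (m%:Z - 1)) ^+ 2 =
    c%:Z * (c%:Z - m%:Z) ^+ 2)%R.
  rewrite (eq_bigr (fun=> ((c%:Z - m%:Z) ^+ 2)%R)); last first.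
    move=> p pC; have := card_nbr_in_line Cl pC; rewrite -/c => <-.
    by congr (_ ^+ 2)%R; clear; lia.
  by rewrite sumr_const -mulr_natl natz.
have := tot; rewrite (bigID (mem C)) /= ins => /(canRL (addKr _)) ->.
have mE : (m.-1%:Z = m%:Z - 1)%R by move: m2; clear; lia.
have cE : (c.-1%:Z = c%:Z - 1)%R by move: c_gt0; clear; lia.
have kE' : (k%:Z = m%:Z * n%:Z - m%:Z)%R.
  by move: kE => /(congr1 Posz); rewrite PoszD PoszM; clear; lia.
have lE' : (l%:Z = m%:Z * (m%:Z - 1) + n%:Z - 2 * m%:Z)%R.
  move: lE; rewrite muE => /(congr1 Posz); rewrite !PoszD !PoszM mE; clear; lia.
by rewrite -mulnn !PoszM !PoszD !PoszM cE kE' lE'; ring.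
Qed.

Lemma line_le C : C \in Ls -> #|C| <= n.
Proof.
move=> Cl; rewrite leqNgt; apply/negP => lt.
have : (0 <= \sum_(p | p \notin C) ((#|nbr p :&: C|)%:Z - (m%:Z - 1)) ^+ 2)%R.
  by apply: sumr_ge0 => p _; rewrite sqr_ge0.
rewrite line_variance // nmulr_rge0; last by rewrite subr_lt0 ltz_nat.
have := Ls_size Cl; rewrite -mulnn => h; apply/negP; rewrite -ltNge.
have h1 : (m * m * #|C| <= #|C| * #|C|)%N by rewrite leq_mul2r ltnW ?orbT.
have h2 : (0 <= (m%:Z - 1) ^+ 2 * n%:Z)%R by rewrite mulr_ge0 ?sqr_ge0.
have h3 : (0 < m * #|C|)%N by rewrite muln_gt0 ltnW //= (leq_trans _ h).
by move: h1 h2 h3; rewrite expr2; set w := (_ ^+ 2 * _)%R; clear; lia.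
Qed.

(** The m lines through x share out its m (n - 1) neighbours, so that none of them
    can have fewer than n points. *)
Lemma line_eq C : C \in Ls -> #|C| = n.
Proof.
move=> Cl; apply/eqP; rewrite eqn_leq line_le //= leqNgt; apply/negP => lt.
have /card_gt0P[x xC] : 0 < #|C| by rewrite (leq_trans _ (Ls_size Cl)).
have sumE : \sum_(D in Ls | x \in D) #|D :\ x| = k.
  rewrite -(reg x) -sum1_card [RHS]big_mkcond /=.
  transitivity (\sum_(D in Ls | x \in D) \sum_u ((u != x) && (u \in D) : nat)).
    apply: eq_bigr => D _; rewrite -sum1_card [LHS]big_mkcond /=.
    by apply: eq_bigr => u _; rewrite !inE; case: (_ && _).
  rewrite exchange_big /=; apply: eq_bigr => u _; rewrite inE.
  have [->|ux] := eqVneq u x; first by rewrite adj_irrefl big1.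
  rewrite (_ : (if adj x u then 1 else 0) = (adj x u : nat)) //.
  rewrite -card_lines_through 1?eq_sym // -sum1_card big_mkcond [RHS]big_mkcond /=.
  apply: eq_bigr => D _; rewrite inE.
  by case: (D \in Ls); case: (x \in D); case: (u \in D).
have : \sum_(D in Ls | x \in D) #|D :\ x| < \sum_(D in Ls | x \in D) n.-1.
  rewrite (bigD1 C) ?Cl //= [X in _ < X](bigD1 C) ?Cl //= -addSn leq_add //.
    by have := cardsD1 x C; rewrite xC; move: lt; clear; lia.
  apply: leq_sum => D /andP[/andP[Dl xD] _].
  by have := cardsD1 x D; have := line_le Dl; rewrite xD; clear; lia.
rewrite sumE (eq_bigl (mem [set D in Ls | x \in D])); last by move=> D; rewrite !inE.
rewrite sum_nat_const Ls_card; move: kE.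
have n_gt0 : 0 < n by apply: leq_ltn_trans lt.
by rewrite -{1}(ltn_predK n_gt0) mulnS; clear; lia.
Qed.

Lemma card_nbr_off_line C p : C \in Ls -> p \notin C -> #|nbr p :&: C| = m.-1.
Proof.
move=> Cl pC; have := line_variance Cl; rewrite line_eq // subrr mul0r => e.
have := psumr_eq0P _ e => /(_ (fun q _ => sqr_ge0 _) p pC) /eqP.
rewrite sqrf_eq0 subr_eq0 => /eqP; move: m2; clear; lia.
Qed.

Definition parallel C C' := (C == C') || (C :&: C' == set0).

Lemma parallel_sym C C' : parallel C C' = parallel C' C.
Proof. by rewrite /parallel eq_sym setIC. Qed.

Lemma parallel_meet C C' x : parallel C C' -> x \in C -> x \in C' -> C = C'.
Proof.
move=> /orP[/eqP //|/eqP/setP/(_ x)] h xC xC'.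
by move: h; rewrite !inE xC xC'.
Qed.

(** Of the m lines through a vertex off C, exactly m - 1 meet C. *)
Lemma exists_parallel p C : C \in Ls ->
  exists C', [/\ C' \in Ls, p \in C' & parallel C' C].
Proof.
move=> Cl; have [pC|pC] := boolP (p \in C); first by exists C; rewrite /parallel eqxx.
have [/existsP[C' /and3P[? ? ?]]|] :=
  boolP [exists C', [&& C' \in Ls, p \in C' & parallel C' C]]; first by exists C'.
rewrite negb_exists => /forallP none; exfalso.
have := nbr_line_meet Cl pC; rewrite card_nbr_off_line //.
have -> : [set C' in Ls | (p \in C') && (C' :&: C != set0)] = [set C' in Ls | p \in C'].
  apply/setP => C'; rewrite !inE; have := none C'; rewrite /parallel.
  by case: (C' \in Ls); case: (p \in C') => //=; rewrite negb_or => /andP[_ ->].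
by rewrite Ls_card; move: m2; clear; lia.
Qed.

Lemma parallel_unique p C C1 C2 : C \in Ls -> C1 \in Ls -> C2 \in Ls ->
  p \in C1 -> p \in C2 -> parallel C1 C -> parallel C2 C -> C1 = C2.
Proof.
move=> Cl C1l C2l p1 p2 h1 h2; have [pC|pC] := boolP (p \in C).
  by rewrite (parallel_meet h1 p1 pC) (parallel_meet h2 p2 pC).
have d (D : {set L}) : p \in D -> parallel D C -> D :&: C = set0.
  by move=> pD /orP[/eqP e|/eqP //]; rewrite -e pD in pC.
have := nbr_line_meet Cl pC; rewrite card_nbr_off_line // => cE.
have e : #|[set C' in Ls | (p \in C') && (C' :&: C == set0)]| + m.-1 = m.
  rewrite cE -[RHS](Ls_card p) -[RHS](cardsID [set C' | C' :&: C == set0]).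
  by congr (_ + _); apply: eq_card => D; rewrite !inE ?andbA // andbC andbA.
have : #|[set C' in Ls | (p \in C') && (C' :&: C == set0)]| <= 1.
  by rewrite -(leq_add2r m.-1) e; move: m2; clear; lia.
by move/card_le1_eqP; apply; rewrite !inE ?C1l ?C2l ?p1 ?p2 d //= eqxx.
Qed.

Lemma parallel_trans C1 C2 C3 : C1 \in Ls -> C2 \in Ls -> C3 \in Ls ->
  parallel C1 C2 -> parallel C2 C3 -> parallel C1 C3.
Proof.
move=> l1 l2 l3 h12 h23; rewrite {1}/parallel -implyNb; apply/implyP => ne.
rewrite -[_ == set0]negbK; apply/negP => /set0Pn[x]; rewrite inE => /andP[x1 x3].
case/eqP: ne; apply: (parallel_unique l2 l1 l3 x1 x3 h12).
by rewrite parallel_sym.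
Qed.

Lemma not_parallel_meet C1 C2 : C1 \in Ls -> C2 \in Ls -> ~~ parallel C1 C2 ->
  #|C1 :&: C2| = 1.
Proof.
move=> l1 l2; rewrite negb_or => /andP[ne m12]; apply/eqP.
by rewrite eqn_leq two_lines_meet_le1 //= card_gt0.
Qed.

Definition par p C : {set L} :=
  odflt set0 [pick C' in Ls | (p \in C') && parallel C' C].

Lemma parP p C : C \in Ls -> [/\ par p C \in Ls, p \in par p C & parallel (par p C) C].
Proof.
move=> Cl; rewrite /par; case: pickP => [C' /and3P[]//|none].
by have [C' [h1 h2 h3]] := exists_parallel p Cl; have := none C'; rewrite h1 h2 h3.
Qed.

Lemma parE p C C' : C \in Ls -> C' \in Ls -> p \in C' -> parallel C' C -> par p C = C'.
Proof.
move=> Cl C'l pC' h; have [l1 p1 h1] := parP p Cl.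
exact: (parallel_unique Cl l1 C'l p1 pC' h1 h).
Qed.

(** The rows of the array are the m parallel classes, represented by the lines
    through a fixed vertex x0; the entry of a column p in a row is the line of
    the class through p, named by its intersection with a transversal line. *)
Lemma oa_block_graph_of_lines : 0 < #|L| -> is_oa_block_graph L.
Proof.
move=> L_gt0; have /card_gt0P[x0 _] := L_gt0; pose A0 := [set C in Ls | x0 \in C].
pose row (i : 'I_#|A0|) : {set L} := enum_val i.
have row_l i : row i \in Ls by have := enum_valP i; rewrite inE => /andP[].
have row_x i : x0 \in row i by have := enum_valP i; rewrite inE => /andP[].
have row_par i j : parallel (row i) (row j) -> i = j.
  by move=> h; apply: enum_val_inj; apply: parallel_meet h (row_x i) (row_x j).
have tr_ex (i : 'I_#|A0|) : exists j : 'I_#|A0|, j != i.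
  have : 1 < #|'I_#|A0| | by rewrite card_ord Ls_card.
  by rewrite (cardD1 i) inE ltnS => /card_gt0P[j]; rewrite !inE andbT; exists j.
pose T i := odflt (row i) (omap row [pick j | j != i]).
have TP i : exists2 j, j != i & T i = row j.
  rewrite /T; case: pickP => [j ji|none]; first by exists j.
  by have [j] := tr_ex i; rewrite none.
have T_l i : T i \in Ls by have [j _ ->] := TP i.
have n_gt0 : 0 < n by move: L_gt0; rewrite vE; case: n.
pose pt i C := odflt x0 [pick u in C :&: T i].
have ptP i C : C \in Ls -> parallel C (row i) -> C :&: T i = [set pt i C].
  move=> Cl Ci; have : #|C :&: T i| = 1.
    apply: not_parallel_meet => //; apply/negP => CT.
    have [j ji TE] := TP i; case/eqP: ji; apply: row_par; rewrite -TE.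
    by apply: parallel_trans Ci => //; rewrite parallel_sym.
  move/eqP/cards1P => [u uE]; rewrite /pt uE; case: pickP => [v|/(_ u)].
    by rewrite inE => /eqP ->.
  by rewrite inE eqxx.
(* Transversals have n points, so that the index of a point is below n. *)
pose code i u : 'I_n := insubd (Ordinal n_gt0) (index u (enum (T i))).
have codeE i u : u \in T i -> code i u = index u (enum (T i)) :> nat.
  move=> uT; rewrite /code insubdK // -topredE /=.
  by rewrite -(line_eq (T_l i)) cardE index_mem mem_enum.
have eL : n ^ 2 = #|L| by rewrite vE.
pose col (j : 'I_(n ^ 2)) : L := enum_val (cast_ord eL j).
pose colI (x : L) : 'I_(n ^ 2) := cast_ord (esym eL) (enum_rank x).
have colK : cancel col colI.
  by move=> j; rewrite /col /colI enum_valK cast_ordK.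
have colIK : cancel colI col.
  by move=> x; rewrite /col /colI cast_ordKV enum_rankK.
pose cls i x := par x (row i).
have clsP i x : [/\ cls i x \in Ls, x \in cls i x & parallel (cls i x) (row i)].
  exact: parP.
pose A : 'M['I_n]_(#|A0|, n ^ 2) :=
  (\matrix_(i, j) code i (pt i (cls i (col j))))%R.
have pt_mem i x : pt i (cls i x) \in cls i x :&: T i.
  by have [c1 _ c3] := clsP i x; rewrite (ptP i _ c1 c3) inE.
have clsE i x C : C \in Ls -> parallel C (row i) -> (x \in C) = (cls i x == C).
  move=> Cl Ci; apply/idP/eqP => [xC|<-]; last by have [] := clsP i x.
  exact: parE.
have codeP i x C : C \in Ls -> parallel C (row i) ->
    (code i (pt i (cls i x)) == code i (pt i C)) = (x \in C).
  move=> Cl Ci; rewrite (clsE i) //; apply/eqP/eqP => [e|-> //].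
  have h1 := pt_mem i x; have h2 : pt i C \in C :&: T i by rewrite (ptP i) // inE.
  move: h1 h2; rewrite !inE => /andP[p1 pT1] /andP[p2 pT2].
  have /(congr1 (nth x0 (enum (T i)))) := congr1 val e.
  rewrite /= !codeE // !nth_index ?mem_enum // => pE.
  have [c1 _ c3] := clsP i x; rewrite -pE in p2.
  exact: (parallel_unique (row_l i) c1 Cl p1 p2 c3 Ci).
have decode i (a : 'I_n) : exists C, [/\ C \in Ls, parallel C (row i) & code i (pt i C) = a].
  have aT : a < size (enum (T i)) by rewrite -cardE line_eq.
  pose u := nth x0 (enum (T i)) a.
  have uT : u \in T i by rewrite -mem_enum mem_nth.
  have [c1 c2 c3] := clsP i u; exists (cls i u); split=> //.
  have : u \in cls i u :&: T i by rewrite inE c2.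
  rewrite (ptP i _ c1 c3) inE => /eqP <-; apply: val_inj => /=.
  by rewrite codeE // index_uniq // enum_uniq.
exists #|A0|, n, A; split.
  move=> i1 i2 ne a b.
  have [Ca [Cal Cap Cac]] := decode i1 a; have [Cb [Cbl Cbp Cbc]] := decode i2 b.
  have meet : #|Ca :&: Cb| = 1.
    apply: not_parallel_meet => //; apply: contraNN ne => h; apply/eqP.
    apply: row_par; apply: (parallel_trans _ Cal) => //; first by rewrite parallel_sym.
    exact: (parallel_trans Cal Cbl).
  rewrite -[RHS]meet -[LHS](card_imset _ (can_inj colK)); apply: eq_card => x.
  rewrite -[x]colIK mem_imset; last exact: (can_inj colK).
  by rewrite !inE !mxE -Cac -Cbc !codeP.
exists colI; split; first by exists col.
move=> x y; rewrite /= /oa_adj (can_eq colIK); have [<-|xy] := eqVneq x y.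
  by rewrite adj_irrefl.
rewrite /=; apply/existsP/idP => [[i]|axy].
  rewrite !mxE !colIK; have [c1 c2 c3] := clsP i y.
  by rewrite codeP // => xc; apply: Ls_clique c1 xc c2 xy.
have [C [Cl xC yC]] := Ls_edge axy.
have [D [Dl xD DC]] := exists_parallel x0 Cl.
have DA : D \in A0 by rewrite inE Dl.
exists (enum_rank_in DA D); rewrite !mxE !colIK.
have Ci : parallel C (row (enum_rank_in DA D)).
  by rewrite /row enum_rankK_in // parallel_sym.
by move: xC yC; rewrite !(clsE _ _ _ Cl Ci) => /eqP -> /eqP ->.
Qed.

End Array.
End LinearSpace.

(** * Strongly regular graphs with smallest eigenvalue -m *)

(** The first term bounds r through integrality, the second is the threshold
    beyond which the lines form a geometry. *)
Definition srg_r_bound (m : nat) : nat :=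
  m * (144 * m ^ 5 + m ^ 2) ^ 2 + 20 * m ^ 4.

Definition srg_order_bound (m : nat) : nat :=
  (144 * m ^ 5 + srg_r_bound m * m) *
  (144 * m ^ 5 + m * (srg_r_bound m).+1).

Section Dichotomy.
Variables (R : realType) (L : sgraph) (k l mu r m : nat).
Hypothesis srgL : srg L k l mu.
Hypothesis kE : k = mu + r * m.
Hypothesis lE : l + m = mu + r.
Hypothesis vE : mu * #|L| = (mu + r * m.-1) * (mu + m * r.+1).
Hypothesis m2 : 1 < m.
Hypothesis mu_gt0 : 0 < mu.
Hypothesis r_gt0 : 0 < r.
Hypothesis mu2 : 2 * mu <= k.

Lemma srg_mu_square : mu = m ^ 2 -> 20 * m ^ 4 < r -> is_steiner_block_graph L.
Proof.
move=> muE rl; have mu_le : mu <= m ^ 2 by rewrite muE.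
apply: (@steiner_block_graph_of_lines L k l mu m (lines L l mu m)) => //.
- by move=> C x y Cl; apply: (elimT (cliqueP _) (line_clique Cl)).
- by move=> C p Cl; apply: line_maximal Cl.
- exact: (edge_line srgL kE lE m2 mu_le rl).
- exact: (line_unique srgL lE m2 mu_le rl).
- exact: (card_lines srgL kE lE m2 mu_le rl).
Qed.

Lemma srg_mu_oblong : mu = m * m.-1 -> 20 * m ^ 4 < r -> is_oa_block_graph L.
Proof.
move=> muE rl; have mu_le : mu <= m ^ 2 by rewrite muE -mulnn leq_mul2l leq_pred orbT.
have [n mE] : exists n, m = n.+1 by exists m.-1; rewrite (ltn_predK m2).
have cE : #|L| = (r + m) ^ 2.
  have n0 : 0 < mu by [].
  apply/eqP; rewrite -(eqn_pmul2l n0) vE muE mE /=; apply/eqP; ring.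
apply: (@oa_block_graph_of_lines L k l mu m (lines L l mu m) srgL m2 _ _ _ _ (r + m)) => //.
- by move=> C x y Cl; apply: (elimT (cliqueP _) (line_clique Cl)).
- exact: (edge_line srgL kE lE m2 mu_le rl).
- exact: (line_unique srgL lE m2 mu_le rl).
- exact: (card_lines srgL kE lE m2 mu_le rl).
- by rewrite kE muE mE /=; ring.
- by move: lE; clear; lia.
- exact: (line_size lE m2 mu_le rl).
- by rewrite cE expn_gt0 addn_gt0 r_gt0.
Qed.

(** Apart from the two values of mu that geometry takes care of, the
    parameters are bounded, by the multiplicity of the eigenvalue r. *)
Lemma srg_dichotomy :
  [\/ #|L| <= srg_order_bound m, is_oa_block_graph L | is_steiner_block_graph L].
Proof.
have [f [fE vf]] := srg_multiplicity R srgL kE lE vE m2 mu_gt0.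
have mub := mu_bound kE vE fE vf mu2 mu_gt0 r_gt0 m2.
have small : r <= srg_r_bound m -> #|L| <= srg_order_bound m.
  by move=> rb; apply: (card_bound vE mu_gt0 mub rb).
case: (leqP r (20 * m ^ 4)) => [rl|rl].
  by apply: Or31; apply: small; rewrite (leq_trans rl) // leq_addl.
have [e1|n1] := eqVneq mu (m ^ 2); first by apply: Or33; apply: srg_mu_square.
have [e2|n2] := eqVneq mu (m * m.-1); first by apply: Or32; apply: srg_mu_oblong.
apply: Or31; apply: small.
have rb := r_bound kE vE fE m2 n1 n2.
rewrite (leq_trans rb) // /srg_r_bound -[X in X <= _]addn0 leq_add //.
by rewrite leq_mul2l leq_sqr leq_add2r mub orbT.
Qed.

End Dichotomy.

(** * Consequences of tightness *)

Section Bipartite.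
Variables (R : realType) (G : sgraph) (k : nat).
Hypothesis conG : connected_graph G.
Hypothesis regG : regular_graph G k.
Hypothesis k_gt0 : 0 < k.
Hypothesis G_gt0 : 0 < #|G|.
Local Open Scope ring_scope.

(** For the eigenvalue -k the vectors of two adjacent vertices are opposite, so
    the sign of the cosine is a proper colouring. *)
Lemma bipartite_of_min_eigenvalue (sigma : nat -> R) :
  cosine_seq G (- k%:R) sigma -> bipartite G.
Proof.
move=> cosS; have [s0 _ [c c0 cE]] := cosS.
have s1 : sigma 1%N = -1.
  have := cos1 conG regG G_gt0 cosS; rewrite -mulrN1 => /mulfI; apply.
  by rewrite pnatr_eq0 -lt0n.
have opp (x y w : G) : adj x y -> sigma (dist x w) = - sigma (dist y w).
  move=> xy; have d1 : dist x y = 1%N by apply/eqP; rewrite dist1.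
  have e : \sum_z (sigma (dist x z) + sigma (dist y z)) ^+ 2 = 0.
    transitivity (\sum_z (sigma (dist x z) * sigma (dist z x)
       + sigma (dist x z) * sigma (dist z y) *+ 2 + sigma (dist y z) * sigma (dist z y))).
      apply: eq_bigr => z _; rewrite (dist_sym conG z x) (dist_sym conG z y); ring.
    by rewrite !big_split /= !cE !dist_refl d1 s0 s1; ring.
  have := psumr_eq0P _ e => /(_ (fun z _ => sqr_ge0 _) w isT) /eqP.
  by rewrite sqrf_eq0 addr_eq0 => /eqP.
have /card_gt0P[x0 _] := G_gt0.
have nz (x : G) : sigma (dist x x0) != 0.
  move: {2}(dist x x0) (erefl (dist x x0)) => n.
  elim: n x => [|n IH] x dn; first by rewrite dn s0 oner_eq0.
  have [z xz zn] := dist_step conG dn.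
  by rewrite (opp _ _ _ xz) oppr_eq0 IH.
exists (fun x => 0 < sigma (dist x x0)) => x y xy.
rewrite (opp _ _ x0 xy) oppr_gt0; have := nz y.
by case: ltrgt0P.
Qed.

End Bipartite.

Section TightArithmetic.
Variable R : realType.
Local Open Scope ring_scope.

(** After clearing denominators, the two sides differ by k times a polynomial
    whose product by a + 1 vanishes by tightness. *)
Lemma tight_identity (k a b t1 tD : R) : k = 1 + a + b -> 0 <= a ->
  1 + t1 != 0 -> 1 + tD != 0 ->
  (t1 + k / (a + 1)) * (tD + k / (a + 1)) = - (k * a * b / (a + 1) ^+ 2) ->
  let r := -1 - b / (1 + tD) in let s := -1 - b / (1 + t1) in
  k * (a + r * s) = (a - r) * (a - s).
Proof.
move=> kE a0 n1 nD e /=.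
have a1 : a + 1 != 0 by rewrite gt_eqF // ltr_wpDl.
have e' : (t1 * (a + 1) + k) * (tD * (a + 1) + k) = - (k * a * b).
  have := congr1 (fun u => u * (a + 1) ^+ 2) e.
  rewrite mulNr divfK ?expf_neq0 // => <-; field; exact: a1.
pose x := 1 + t1; pose y := 1 + tD.
have Q0 : (a + 1) * x * y + b * (x + y) + b ^+ 2 + a * b = 0.
  apply: (mulfI a1); rewrite mulr0.
  have -> : 0 = (t1 * (a + 1) + k) * (tD * (a + 1) + k) + k * a * b.
    by rewrite e' addNr.
  by rewrite kE /x /y; ring.
have t1E : t1 = x - 1 by rewrite /x; ring.
have tDE : tD = y - 1 by rewrite /y; ring.
rewrite -/x -/y in n1 nD *; clearbody x y.
have -> : k * (a + (-1 - b / y) * (-1 - b / x)) =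
    k * ((a + 1) * x * y + b * (x + y) + b ^+ 2 + a * b) / (x * y) - k * a * b / (x * y).
  by field; rewrite n1 nD.
have -> : (a - (-1 - b / y)) * (a - (-1 - b / x)) =
    (t1 * (a + 1) + k) * (tD * (a + 1) + k) / (x * y).
  by rewrite kE t1E tDE; field; rewrite n1 nD.
by rewrite Q0 e' mulr0 mul0r add0r mulNr.
Qed.

End TightArithmetic.

Section LocalParameters.
Variables (R : realType) (G : sgraph) (k a1 : nat).
Hypothesis conG : connected_graph G.
Hypothesis regG : regular_graph G k.
Hypothesis commG : forall x y : G, adj x y -> #|nbr x :&: nbr y| = a1.
Hypothesis k_gt0 : 0 < k.
Hypothesis a1_gt0 : 0 < a1.
Local Open Scope ring_scope.
Variables (r s : R).
Hypothesis two_eig : forall x : G,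
  (adjmx R (local_graph x) - r%:M) *m (adjmx R (local_graph x) - s%:M) =
  (a1%:R + r * s) *: const_mx 1.

(** The quadratic equation of the local adjacency matrix, read entrywise. *)
Lemma local_common (x : G) (u w : local_graph x) : u != w ->
  #|nbr u :&: nbr w|%:R = a1%:R + r * s + (r + s) * (adj u w)%:R :> R.
Proof.
move=> uw; have /matrixP/(_ (enum_rank u) (enum_rank w)) := two_eig x.
rewrite mulmxBl !mulmxBr !(mul_scalar_mx, mul_mx_scalar).
move: (adjmx_sqr R (enum_rank u) (enum_rank w)); move: (_ *m _) => XX e.
rewrite !mxE e !enum_rankK (inj_eq enum_rank_inj) (negbTE uw) !mulr0n.
lra.
Qed.

Lemma card_local_common (x y z : G) : adj x y -> adj x z -> (1 < dist y z)%N ->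
  #|[set v | adj x v && (adj y v && adj z v)]|%:R = a1%:R + r * s :> R.
Proof.
move=> xy xz yz.
have yS : y \in sphere 1 x by rewrite in_sphere1.
have zS : z \in sphere 1 x by rewrite in_sphere1.
pose u : local_graph x := exist _ y yS; pose w : local_graph x := exist _ z zS.
have yz' : y != z by rewrite -(dist_eq0 conG) -lt0n ltnW.
have nyz : adj y z = false by rewrite -(dist1 conG) gtn_eqF.
have uw : u != w by rewrite -val_eqE.
have nuw : adj u w = false by exact: nyz.
have := local_common uw; rewrite nuw mulr0 addr0 => <-; congr (_%:R).
rewrite -(@card_local R G conG x (fun v => adj y v && adj z v)).
by apply: eq_card => v; rewrite !inE.
Qed.

Lemma local_mu_ge0 : (0 < #|G|)%N -> (2 <= diameter G)%N -> 0 <= a1%:R + r * s.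
Proof.
move=> G0 D2; have [y [z yz]] := exists_dist conG D2 G0.
have [x yx xz] := dist_step conG yz.
rewrite -(@card_local_common x y z) ?ler0n ?yz //; first by rewrite adj_sym.
by rewrite -dist1 // xz.
Qed.

Hypothesis r_int : r \is a Num.int.
Hypothesis s_int : s \is a Num.int.
Hypothesis mu_pos : 0 < a1%:R + r * s.

Lemma local_srg (x : G) : exists mu l : nat,
  [/\ mu%:R = a1%:R + r * s, l%:R = mu%:R + r + s & srg (local_graph x) a1 l mu].
Proof.
have regL := local_regular R conG commG (x := x).
have /natrP[mu muE] : a1%:R + r * s \is a Num.nat.
  by rewrite natrEint ltW // andbT rpredD ?rpredM // natr_int.
have [u [w uw]] : exists u w : local_graph x, adj u w.
  have /card_gt0P[u _] : (0 < #|local_graph x|)%N.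
    by rewrite (card_local_graph conG regG).
  have : (0 < #|nbr u|)%N by rewrite regL.
  by case/card_gt0P => w; rewrite inE; exists u, w.
have uw' : u != w by apply: adj_neq.
exists mu, #|nbr u :&: nbr w|; have e := local_common uw'; rewrite uw mulr1 in e.
split; [by rewrite muE | by rewrite e muE; ring |].
split=> // y z yz; apply/eqP; rewrite -(eqr_nat R) local_common //.
case: (adj y z); first by rewrite e mulr1.
by rewrite mulr0 addr0 muE.
Qed.

(** The common neighbours of the middle edge of a geodesic of length 3 split
    according to the end of the geodesic to which they are adjacent. *)
Lemma twice_local_mu_le (mu : nat) : mu%:R = a1%:R + r * s ->
  (0 < #|G|)%N -> (3 <= diameter G)%N -> (2 * mu <= a1)%N.
Proof.
move=> muE G0 D3.
have cn (x y z : G) : adj x y -> adj x z -> (1 < dist y z)%N ->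
    #|[set v | adj x v && (adj y v && adj z v)]| = mu.
  by move=> xy xz yz; apply/eqP; rewrite -(eqr_nat R) muE card_local_common.
have [w0 [w3 d3]] := exists_dist conG D3 G0.
have [x1 w0x1 d2] := dist_step conG d3.
have [x2 x12 d1] := dist_step conG d2.
have x2w3 : adj x2 w3 by rewrite -dist1 // d1.
have h1 : (1 < dist w0 x2)%N.
  by have := dist_triangle conG w0 x2 w3; rewrite d3 d1; clear; lia.
have h2 : (1 < dist x1 w3)%N by rewrite d2.
have x10 : adj x1 w0 by rewrite adj_sym.
have x21 : adj x2 x1 by rewrite adj_sym.
rewrite mul2n -addnn -{1}(cn _ _ _ x10 x12 h1) -{1}(cn _ _ _ x21 x2w3 h2).
rewrite -(commG x12) -cardsUI (_ : _ :&: [set v | adj x2 v && _] = set0) ?cards0 ?addn0.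
  apply/subset_leq_card/subsetP => v; rewrite !inE.
  by case/orP => /and3P[e1 e2 e3]; rewrite ?e1 ?e2 ?e3.
apply/setP => v; rewrite !inE; apply/negP => /andP[/and3P[_ w0v _] /and3P[_ _ w3v]].
have := dist_adj_le conG w3 w0v; rewrite d3 (eqP (_ : dist v w3 == 1%N)) //.
by rewrite dist1 // adj_sym.
Qed.

End LocalParameters.

Local Open Scope ring_scope.

Theorem theorem1p3 (R : realType) :
  exists f g : R -> R,
  forall (G : sgraph) (p : nat -> nat -> nat -> nat) (theta : seq R),
    distance_regular G p ->
    (3 <= diameter G)%N ->
    drg_eigenvalues G p theta ->
    tight G p theta ->
    let b1 : R := (inter_b p 1)%:R in
    let b : R := b1 / (1 + theta`_1) in
    2 <= b ->
    - 1 - b1 / (1 + theta`_(diameter G)) \is a Num.int ->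
    - 1 - b1 / (1 + theta`_1) \is a Num.int ->
    (exists x : G, ~ is_oa_block_graph (local_graph x) /\
                   ~ is_steiner_block_graph (local_graph x)) ->
    (valency p)%:R <= f b /\ (diameter G)%:R <= g b.
Proof.
(* The smallest local eigenvalue is the integer s = - (1 + b). *)
pose f0 (b : R) := srg_order_bound (Num.truncn (1 + b)).
exists (fun b => (f0 b)%:R), (fun b => (f0 b + 2)%:R).
move=> G p theta drG D3 [szT T0 sortT eigT] [nbip tightE] b1 b b2 rint sint
  [x [noOA noSt]].
have conG := drG.1.
have G_gt0 : (0 < #|G|)%N by apply/card_gt0P; exists x.
have D2 : (2 <= diameter G)%N by apply: ltnW.
have D0 : (0 < diameter G)%N by apply: ltnW.
pose k := p 0 1 1; pose a1 := p 1 1 1; pose c := p 1 1 2.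
have regG : regular_graph G k := drg_regular drG D2.
have commG (y z : G) : adj y z -> #|nbr y :&: nbr z| = a1 by apply: drg_common drG D2 _ _.
have kE : k = (1 + a1 + c)%N := drg_valency_split drG D2 G_gt0.
pose t1 := theta`_1; pose tD := theta`_(diameter G).
have {}T0 : theta`_0 = k%:R := T0.
have {}tightE : (t1 + k%:R / (a1%:R + 1)) * (tD + k%:R / (a1%:R + 1)) =
    - (k%:R * a1%:R * c%:R / (a1%:R + 1) ^+ 2) := tightE.
pose r : R := -1 - b1 / (1 + tD); pose s : R := -1 - b1 / (1 + t1).
have sE : s = - (1 + b) by rewrite /s /b -/t1; ring.
have b1E : b1 = c%:R by [].
have b1_ge0 : 0 <= b1 by rewrite ler0n.
have t1_gt : 0 < 1 + t1.
  rewrite ltNge; apply/negP => h; have : b <= 0 by rewrite /b mulr_ge0_le0 ?invr_le0.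
  by move: b2; lra.
have c_gt0 : (0 < c)%N.
  rewrite lt0n; apply/eqP => c0; move: b2; rewrite /b b1E c0 mul0r; lra.
have t1k : t1 < k%:R.
  have /(sortedP 0) := sortT; rewrite -T0 => /(_ 0%N); rewrite szT; apply.
  by rewrite ltnS.
have kR : k%:R = 1 + a1%:R + c%:R :> R by rewrite kE !natrD.
have a1_ge0 : 0 <= a1%:R :> R by rewrite ler0n.
have cR : 0 < c%:R :> R by rewrite ltr0n.
have aR : 0 < a1%:R + 1 :> R by lra.
have tD_lt : 1 + tD < 0.
  have q1 : 1 < k%:R / (a1%:R + 1) :> R by rewrite ltr_pdivlMr //; lra.
  have h1 : 0 < t1 + k%:R / (a1%:R + 1) by lra.
  have h2 : tD + k%:R / (a1%:R + 1) <= 0.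
    rewrite -(pmulr_rle0 _ h1) tightE oppr_le0.
    by rewrite divr_ge0 ?(exprn_ge0 _ (ltW aR)) // !mulr_ge0 ?ler0n.
  lra.
have nD : 1 + tD != 0 by rewrite lt_eqF.
have n1 : 1 + t1 != 0 by rewrite gt_eqF.
have num : k%:R * (a1%:R + r * s) = (a1%:R - r) * (a1%:R - s).
  exact: (tight_identity kR a1_ge0 n1 nD tightE).
have eig i : (i <= diameter G)%N -> eigenvalue (adjmx R G) theta`_i.
  by move=> iD; rewrite -eigT mem_nth // szT ltnS.
have [sigma cosS] := cosine_sequence drG D0 (eig 1%N D0).
have [rho cosR] := cosine_sequence drG D0 (eig _ (leqnn _)).
have k_gt0 : (0 < k)%N by rewrite kE.
have a1_gt0 : (0 < a1)%N.
  rewrite lt0n; apply/eqP => a10; apply: nbip.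
  apply: (bipartite_of_min_eigenvalue conG regG k_gt0 G_gt0 (sigma := rho)).
  suff <- : tD = - k%:R by [].
  move: tightE; rewrite a10 add0r !divr1 mulr0 !mul0r oppr0 => /eqP.
  rewrite mulf_eq0 => /orP[/eqP h|/eqP h]; last lra.
  by have : 1 <= k%:R :> R by [rewrite ler1n]; lra.
have two_eig := local_two_eigenvalues conG regG commG kE c_gt0 G_gt0 cosS cosR
  t1k t1_gt tD_lt num.
have kR0 : 0 < k%:R :> R by rewrite ltr0n.
have a1R : 0 < a1%:R :> R by rewrite ltr0n.
have s_lt : s < -1 by exact: (local_s_lt c_gt0 t1_gt).
have r_gt1 : -1 < r by exact: (local_r_gt c_gt0 tD_lt).
have as_gt : 0 < a1%:R - s by lra.
have rs : s < r by lra.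
have mu_ge0 := local_mu_ge0 conG two_eig G_gt0 D2.
have r_lt : r < a1%:R.
  rewrite lt_neqAle -subr_ge0 -(pmulr_lge0 _ as_gt) -num (mulr_ge0 (ltW kR0) mu_ge0) andbT.
  apply/eqP => ra; move/eqP: num; rewrite ra subrr mul0r mulf_eq0 gt_eqF //=.
  have -> : a1%:R + a1%:R * s = a1%:R * (1 + s) by ring.
  by rewrite mulf_eq0 gt_eqF //= => /eqP; move: s_lt; lra.
have mu_pos : 0 < a1%:R + r * s.
  by rewrite -(pmulr_rgt0 _ kR0) num mulr_gt0 // subr_gt0.
have [mu [l [muE lE srgL]]] := local_srg conG regG commG k_gt0 a1_gt0 two_eig
  rint sint mu_pos x.
have {}muE : mu%:R = a1%:R + r * s := muE.
have {}lE : l%:R = mu%:R + r + s := lE.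
have mu2 := twice_local_mu_le conG commG two_eig muE G_gt0 D3.
have mu2R : 2 * mu%:R <= a1%:R :> R by rewrite -natrM ler_nat.
have r_gt0 : 0 < r.
  rewrite -(nmulr_llt0 _ (lt_trans s_lt (ltrN10 R))).
  by move: mu2R; rewrite muE; move: (r * s) => q h; lra.
have /natrP[r' rE] : r \is a Num.nat by rewrite natrEint ltW // andbT.
have b_int : b \is a Num.int.
  have -> : b = -1 - s by rewrite sE; ring.
  by rewrite rpredB // rpredN1.
have /natrP[m mE] : 1 + b \is a Num.nat.
  have p1b : 0 <= 1 + b by lra.
  by rewrite natrEint p1b rpredD ?rpred1.
have m3 : (3 <= m)%N by rewrite -(ler_nat R) -mE; move: b2; lra.
have sm : s = - m%:R by rewrite sE mE.
have kLE : #|local_graph x| = k := card_local_graph conG regG x.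
have order : [\/ (#|local_graph x| <= srg_order_bound m)%N,
    is_oa_block_graph (local_graph x) | is_steiner_block_graph (local_graph x)].
  have mn : m = m.-1.+1 by rewrite (ltn_predK m3).
  have mR : m.-1%:R = m%:R - 1 :> R by rewrite [in RHS]mn -natr1 addrK.
  apply: (@srg_dichotomy R _ a1 l mu r' m srgL).
  - apply/eqP; rewrite -(eqr_nat R) natrD natrM muE -rE sm; apply/eqP; ring.
  - apply/eqP; rewrite -(eqr_nat R) !natrD lE -rE sm; apply/eqP; ring.
  - apply/eqP; rewrite -(eqr_nat R) kLE !(natrM, natrD) mR -natr1 -rE mulrC.
    by rewrite muE num sm; apply/eqP; have : a1%:R = mu%:R + r * m%:R :> R;
      [rewrite muE sm; ring | rewrite muE sm => ->; ring].
  - exact: ltnW.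
  - by rewrite -(ltr_nat R) muE.
  - by rewrite -(ltr_nat R) -rE.
  - exact: mu2.
have kb : (k <= f0 b)%N by rewrite /f0 mE natrK -kLE; case: order.
split; first by rewrite ler_nat.
rewrite ler_nat.
have sig1 := cos1_lt conG regG kE G_gt0 cosS t1k.
have rho1 := cos1D_lt conG regG kE G_gt0 cosR tD_lt.
have two_eig' (y : G) : (adjmx R (local_graph y) - s%:M) *m (adjmx R (local_graph y) - r%:M) =
    (a1%:R + r * s) *: const_mx 1.
  by rewrite -two_eig; apply: scalar_shift_comm.
have num' : k%:R * (a1%:R + r * s) = (a1%:R - s) * (a1%:R - r) by rewrite num mulrC.
have depS := dependency conG regG commG kE G_gt0 cosS n1 sig1 two_eig' num'.
have depR := dependency conG regG commG kE G_gt0 cosR nD rho1 two_eig num.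
have rS := eta'E conG regG commG kE G_gt0 cosS n1 sig1 two_eig' num'.
have r2 : 2 * r < a1%:R.
  have : (a1%:R - r) * sigma 1%N < a1%:R - r by rewrite gtr_pMr // subr_gt0.
  by rewrite -rS; lra.
have s2 : 2 * s < a1%:R by move: s_lt a1R; lra.
have loc := local_le_r_sum conG regG commG kE c_gt0 G_gt0 cosR tD_lt.
have := diameter_le drG commG G_gt0 cosS cosR depS depR r2 s2 rs loc.
move=> h; apply: leq_trans h _; rewrite leq_add2r (leq_trans _ kb) // kE.
by clear; lia.
Qed.
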